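(* Let $\delta\in(0,1)$. Consider Contaminated Best Arm Identification (CBAI) against an oblivious, prescient, or malicious adversary, with $F_i\in\mathcal{F}_{\bar t,B}$ and $m_2(F_i)\le\bar m_2$ for each arm $i\in[k]$. Let $N:=2\left(\bar t-\tfrac{\varepsilon}{2(1-\varepsilon)}\right)^{-2}$ for oblivious and prescient adversaries and $N:=2(\bar t-\varepsilon)^{-2}$ for malicious adversaries, and let $\alpha_{r,\delta'}:=\sqrt{2B^2\bar m_2^2\log(3/\delta')/r}$. Consider the following algorithm. Initialize $S\leftarrow[k]$, $r\leftarrow1$, and sample each arm $\lceil N\log(\tfrac{\pi^2k}{2\delta})\rceil$ times. While $|S|>1$: sample each arm $i\in S$ for $1+\lceil2N\log(\tfrac{r+1}{r})\rceil$ times and let $\hat p_{i,r}$ be the empirical median of all past samples of arm $i$; set $$S\leftarrow\left\{i\in S:\ \hat p_{i,r}\ge\max_{j\in S}\hat p_{j,r}-2\alpha_{r,\,6\delta/(\pi^2kr^2)}\right\};$$ set $r\leftarrow r+1$. Output the only arm left in $S$. With probability at least $1-\delta$, this algorithm outputs the optimal arm $i^*$ after using at most $$\tilde O\left(\sum_{i\ne i^*}\left(\frac{1}{\tilde\Delta_i^2}+N\right)\log\left(\frac{k}{\delta\tilde\Delta_i}\right)\right)$$ samples.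
   Context: Notation. Distributions are on $\mathbb{R}$ and identified with cdfs. $Q_{L,F}(p)=\inf\{x:F(x)\ge p\}$, $Q_{R,F}(p)=\inf\{x:F(x)>p\}$. $m_1(F)$ is the (unique) median of $F$ and $m_2(F)$ is the median of $|X-m_1(F)|$, $X\sim F$. The empirical median is the middle value for an odd number of samples, and the average of the two middle values otherwise. For $\bar t\in(0,\tfrac12)$, $B>0$, $\mathcal{F}_{\bar t,B}$ is the family of distributions $F$ with a unique median and $|F(x_1)-F(x_2)|\ge\frac{1}{B\,m_2(F)}|x_1-x_2|$ for all $x_1,x_2\in[Q_{L,F}(\tfrac12-\bar t),Q_{R,F}(\tfrac12+\bar t)]$. $\tilde O$ hides constants (which may depend on $B$ and $\bar m_2$) and lower-order logarithmic factors. CBAI. There are $k\ge2$ arms with unknown true distributions $F_1,\dots,F_k$ and a contamination level $\varepsilon\in(0,\tfrac12)$. At each iteration $t$ an algorithm picks an arm $I_t\in[k]$ and observes $X_{I_t,t}$, where $X_{i,t}=(1-D_{i,t})Y_{i,t}+D_{i,t}Z_{i,t}$, $Y_{i,t}\sim F_i$, $D_{i,t}\sim\mathrm{Ber}(\varepsilon)$, and $Z_{i,t}$ is an arbitrary contamination. Adversaries: - Oblivious: for each $i$ the triples $(Y_{i,t},D_{i,t},Z_{i,t})_{t\ge1}$ are independent across $t$; $Y_{i,t}$ and $D_{i,t}$ are independent. - Prescient: for each $i$ the pairs $(Y_{i,t},D_{i,t})_{t\ge1}$ are independent across $t$, $Y_{i,t}$ and $D_{i,t}$ are independent, and each $Z_{i,t}$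 may depend on all of $\{Y_{j,s},D_{j,s},Z_{j,s}\}_{j\in[k],s\ge1}$. - Malicious: as prescient, but $Y_{i,t}$ and $D_{i,t}$ need not be independent of each other. No independence across arms is required for fixed $t$. The parameters satisfy $\tfrac{\varepsilon}{2(1-\varepsilon)}<\bar t<\tfrac12$ (oblivious, prescient) or $\varepsilon<\bar t<\tfrac12$ (malicious), and are known to the algorithm. The unavoidable uncertainty of arm $i$ is $U_i=B\,m_2(F_i)\frac{\varepsilon}{2(1-\varepsilon)}$ for oblivious and prescient adversaries and $U_i=B\,m_2(F_i)\,\varepsilon$ for malicious ones. With $i^*=\arg\max_i m_1(F_i)$ the optimal arm, the effective gaps are $\tilde\Delta_i=(m_1(F_{i^*})-U_{i^*})-(m_1(F_i)+U_i)$, assumed strictly positive for all $i\ne i^*$.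
   Formalization: The logarithm is log(k/(δ·min(1,gap))), since the displayed one is ≤ 0 for gaps ≥ k/δ, where the bound fails; and t in X_{i,t} counts the pulls of arm i rather than global iterations, since a prescient adversary could otherwise steer which samples are read. *)

(* Defs.v *)
(* MathComp / MathComp-Analysis. *)
From HB Require Import structures.
From mathcomp Require Import all_boot all_order all_algebra.
From mathcomp Require Import all_classical all_reals all_analysis.

Set Implicit Arguments.
Unset Strict Implicit.
Unset Printing Implicit Defensive.

Import Order.TTheory GRing.Theory Num.Theory.
Import numFieldNormedType.Exports.

Local Open Scope classical_set_scope.
Local Open Scope ring_scope.

Section distributions.
Context {R : realType}.
Implicit Types (mu : set R -> \bar R) (F : probability R R).

Definition cdfR mu (x : R) : R := fine (mu `]-oo, x]%classic).

Definition QL mu (p : R) : R := inf [set x | p <= cdfR mu x].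
Definition QR mu (p : R) : R := inf [set x | p < cdfR mu x].

Definition is_median mu (m : R) : Prop :=
  ((2^-1)%:E <= mu `]-oo, m]%classic)%E /\ ((2^-1)%:E <= mu `[m, +oo[%classic)%E.

Definition is_unique_median mu (m : R) : Prop :=
  is_median mu m /\ forall m', is_median mu m' -> m' = m.

(* Law of |X - m| for X ~ F. *)
Definition abs_dev_law F (m : R) : set R -> \bar R :=
  pushforward F (fun x : R => `|x - m|).

(* The family F_{tbar,B}; m1 and m2 are m_1(F) and m_2(F).  The median of
   |X - m1| need not be unique for F in the family, so m2 is any such median
   rather than a canonically chosen one.  [0 < m2] makes the slope 1/(B m2)
   meaningful: 0^-1 = 0 would turn the condition into a void one. *)
Definition in_family (tbar B : R) F (m1 m2 : R) : Prop :=
  [/\ is_unique_median F m1,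
      is_median (abs_dev_law F m1) m2,
      0 < m2 &
      forall x1 x2 : R,
        QL F (2^-1 - tbar) <= x1 <= QR F (2^-1 + tbar) ->
        QL F (2^-1 - tbar) <= x2 <= QR F (2^-1 + tbar) ->
        (B * m2)^-1 * `|x1 - x2| <= `|cdfR F x1 - cdfR F x2|].

Definition empirical_median (s : seq R) : R :=
  let s' := sort <=%R s in
  let n := size s in
  if odd n then s'`_(n./2) else (s'`_(n./2.-1) + s'`_(n./2)) / 2.

End distributions.

Section contamination.
Context {R : realType} {d : measure_display} {T : measurableType d}.
Variable P : probability T R.

Definition independent_seq d' (E : measurableType d') (W : nat -> T -> E) :
    Prop :=
  forall (J : seq nat) (A : nat -> set E), uniq J ->
    (forall t, measurable (A t)) ->
    P [set w | forall t, t \in J -> A t (W t w)] =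
      (\prod_(t <- J) fine (P (W t @^-1` A t)))%:E.

Definition independent_pair d1 d2 (E1 : measurableType d1)
    (E2 : measurableType d2) (V : T -> E1) (W : T -> E2) : Prop :=
  forall (A : set E1) (C : set E2), measurable A -> measurable C ->
    P (V @^-1` A `&` W @^-1` C) = (P (V @^-1` A) * P (W @^-1` C))%E.

End contamination.

Inductive adversary := Oblivious | Prescient | Malicious.

Section adversaries.
Context {R : realType} {d : measure_display} {T : measurableType d}.
Variable P : probability T R.

(* Y i s, D i s, Z i s belong to the (s+1)-st pull of arm i: the time index is
   the arm's own pull count.  With a clock shared by all arms, the elimination
   of one arm would shift the times at which the others are read, and since
   the joint law of different arms is unrestricted, the samples of an arm read
   at these random times need not be independent.  For the prescient and the
   malicious adversary the Z i s are arbitrary random variables, hence may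
   depend on all of the Y j t, D j t and Z j t. *)
Definition contaminated_by (adv : adversary) (k : nat) (eps : R)
    (F : 'I_k -> probability R R)
    (Y : 'I_k -> nat -> {RV P >-> R})
    (D : 'I_k -> nat -> {RV P >-> bool})
    (Z : 'I_k -> nat -> {RV P >-> R}) : Prop :=
  forall i : 'I_k,
  [/\ forall s (A : set R), measurable A ->
        distribution P (Y i s) A = F i A,
      forall s (A : set bool),
        distribution P (D i s) A = bernoulli_prob eps A,
      match adv with
      | Oblivious =>
          independent_seq P
            (fun s w => (Y i s w, D i s w, Z i s w)
              : (R * bool * R)%type)
      | Prescient | Malicious =>
          independent_seq P
            (fun s w => (Y i s w, D i s w) : (R * bool)%type)
      end &
      match adv with
      | Oblivious | Prescient => forall s,
          independent_pair P (Y i s) (D i s)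
      | Malicious => True
      end].

Definition observation (k : nat)
    (Y : 'I_k -> nat -> {RV P >-> R})
    (D : 'I_k -> nat -> {RV P >-> bool})
    (Z : 'I_k -> nat -> {RV P >-> R}) (w : T) : 'I_k -> nat -> R :=
  fun i s => (1 - (D i s w)%:R) * Y i s w + (D i s w)%:R * Z i s w.

End adversaries.

Section bandit.
Context {R : realType}.

(* The contamination enters U_i and N, and the admissible range of tbar, only
   through eps / (2 (1 - eps)) or eps. *)
Definition eff_eps (adv : adversary) (eps : R) : R :=
  match adv with
  | Oblivious | Prescient => eps / (2 * (1 - eps))
  | Malicious => eps
  end.

Definition uncertainty (adv : adversary) (eps B m2 : R) : R :=
  B * m2 * eff_eps adv eps.

Definition eff_gap (adv : adversary) (eps B : R) (k : nat)
    (m1 m2 : 'I_k -> R) (istar i : 'I_k) : R :=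
  (m1 istar - uncertainty adv eps B (m2 istar)) -
  (m1 i + uncertainty adv eps B (m2 i)).

Definition sample_factor (adv : adversary) (eps tbar : R) : R :=
  2 * (tbar - eff_eps adv eps) ^- 2.

Definition alpha (B m2bar : R) (r : nat) (delta' : R) : R :=
  Num.sqrt (2 * B ^+ 2 * m2bar ^+ 2 * ln (3 / delta') / r%:R).

Definition ceil_nat (x : R) : nat := `|Num.ceil x|%N.

Record state (k : nat) := State {
  active : {set 'I_k};
  round : nat;
  pulls : 'I_k -> nat }.

Definition cbai_init (k : nat) (N delta : R) : state k :=
  {| active := [set: 'I_k]%SET;
     round := 1;
     pulls := fun=> ceil_nat (N * ln (pi ^+ 2 * k%:R / (2 * delta))) |}.

(* One pass through the loop body; a state with at most one active arm is
   final and left unchanged.  x i s is the (s+1)-st sample drawn from arm i. *)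
Definition cbai_step (k : nat) (N B m2bar delta : R) (x : 'I_k -> nat -> R)
    (st : state k) : state k :=
  let S := active st in
  let r := round st in
  if (#|S| <= 1)%N then st else
  let n i := if i \in S then
    (pulls st i + (1 + ceil_nat (2 * N * ln (r.+1%:R / r%:R))))%N
    else pulls st i in
  let phat i := empirical_median (mkseq (x i) (n i)) in
  let a := alpha B m2bar r (6 * delta / (pi ^+ 2 * k%:R * r%:R ^+ 2)) in
  (* for i in S the default value phat i is harmless: it is one of the
     values over which the maximum is taken *)
  {| active := [set i in S |
       phat i >= \big[Num.max/phat i]_(j in S) phat j - 2 * a]%SET;
     round := r.+1;
     pulls := n |}.

(* On the sample table x the algorithm stops with istar as the only arm left,
   having drawn at most M samples. *)
Definition outputs_within (k : nat) (N B m2bar delta : R)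
    (x : 'I_k -> nat -> R) (istar : 'I_k) (M : R) : Prop :=
  exists n : nat,
    let st := iter n (cbai_step N B m2bar delta x) (cbai_init k N delta) in
    active st = [set istar]%SET /\ (\sum_i pulls st i)%:R <= M.

(* log(k / (delta gap)), with gaps larger than 1 counted as 1: the expression
   is meant in the regime of bounded gaps (it vanishes at gap = k / delta and
   is negative beyond). *)
Definition log_term (k : nat) (delta gap : R) : R :=
  ln (k%:R / (delta * Num.min 1 gap)).

(* O~(sum_(i != istar) (gap_i^-2 + N) log_i): C is the hidden constant and
   (1 + ln (1 + log_i))^q, polylogarithmic in the displayed logarithm, the
   hidden lower-order logarithmic factor. *)
Definition sample_bound (C : R) (q k : nat) (N delta : R)
    (gap : 'I_k -> R) (istar : 'I_k) : R :=
  C * \sum_(i < k | i != istar)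
        ((gap i ^+ 2)^-1 + N) * log_term k delta (gap i) *
        (1 + ln (1 + log_term k delta (gap i))) ^+ q.

End bandit.

(* Main.v *)
(* Call a sample spoiled for a half-line when it is contaminated or when its
   clean value lies in that half-line. If the median of n samples of an arm
   leaves [m1 - U - a, m1 + U + a] then at least half of them are spoiled for
   one of the two half-lines outside that interval. Spoiled samples are
   independent whatever the adversary does, and the slope condition keeps their
   probability below 1/2 by a margin proportional to a / (B m2) (or to
   tbar - eff_eps, once the deviation exceeds the range where the slope
   condition holds), so a Chernoff bound applies. Outside an event of
   probability at most delta, every confidence interval used holds: the optimal
   arm is never eliminated, and arm i is gone once 4 alpha_r is below its gap,
   which happens at a round r of order log(k / (delta gap)) / gap^2. As the
   number of pulls of an active arm is a deterministic function of the round,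
   only finitely many medians enter the union bound. No extra logarithmic
   factor arises, so q = 0. *)
Require Import Defs.
From HB Require Import structures.
From mathcomp Require Import all_boot all_order all_algebra.
From mathcomp Require Import all_classical all_reals all_analysis.
From mathcomp Require Import measurable_realfun.
From mathcomp Require Import zify ring lra.

Set Implicit Arguments.
Unset Strict Implicit.
Unset Printing Implicit Defensive.

Import Order.TTheory GRing.Theory Num.Theory.
Import numFieldNormedType.Exports.

Local Open Scope classical_set_scope.
Local Open Scope ring_scope.

(** * Empirical medians *)

Lemma sort_nth_le (R : realType) (s : seq R) (x : R) (j : nat) :
  (j < size s)%N -> ((sort <=%R s)`_j <= x) = (j < count (fun y => (y <= x)%R) s)%N.
Proof.
move=> js; have ss : sorted <=%R (sort <=%R s) by apply: sort_sorted; exact: le_total.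
have -> : count (fun y => (y <= x)%R) s = count (<= x)%O (sort <=%R s).
  by apply/esym/permP; rewrite perm_sort.
apply/idP/idP => [|/(nth_count_le 0 ss)//].
apply: contraTT; rewrite -leqNgt -ltNge => h.
by apply: nth_count_gt => //; rewrite h size_sort.
Qed.

Lemma sort_nth_homo (R : realType) (s : seq R) (i j : nat) :
  (i <= j)%N -> (j < size s)%N -> (sort <=%R s)`_i <= (sort <=%R s)`_j.
Proof.
move=> ij js; rewrite sort_nth_le; last exact: leq_ltn_trans js.
by apply: leq_ltn_trans ij _; rewrite -sort_nth_le.
Qed.

Lemma sort_nth_lt (R : realType) (s : seq R) (x : R) (j : nat) :
  (j < size s)%N -> ((sort <=%R s)`_j < x) = (j < count (fun y => y < x)%R s)%N.
Proof.
move=> js; have ss : sorted <=%R (sort <=%R s) by apply: sort_sorted; exact: le_total.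
have -> : count (fun y => (y < x)%R) s = count (< x)%O (sort <=%R s).
  by apply/esym/permP; rewrite perm_sort.
apply/idP/idP => [|/(nth_count_lt 0 ss)//].
apply: contraTT; rewrite -leqNgt -leNgt => h.
by apply: nth_count_ge => //; rewrite h size_sort.
Qed.

(** For an even size, an average above [x] forces the larger of the two middle values above [x]. So
    in both parities the entry of index n/2 exceeds [x], and with it the n - n/2 entries from there
    on. *)
Lemma lt_empirical_median (R : realType) (s : seq R) (x : R) :
  x < empirical_median s -> (size s <= 2 * count (fun y => (x < y)%R) s)%N.
Proof.
have [->|s0] := posnP (size s); first by rewrite leq0n.
have cP := count_predC (fun y : R => y <= x) s.
have -> : count (fun y => (x < y)%R) s = count (predC (fun y : R => (y <= x)%R)) s.
  by apply: eq_count => y /=; rewrite ltNge.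
have key j : (j < size s)%N -> x < (sort <=%R s)`_j ->
    (size s - j <= count (predC (fun y : R => (y <= x)%R)) s)%N.
  move=> js; rewrite ltNge sort_nth_le // -leqNgt => h; move: js cP h.
  by move: (count _ s) (count _ s) (size s) => a b c; lia.
rewrite /empirical_median; have sE := odd_double_half (size s).
case: ifPn => [os /key|os h]; first by move=> /(_ ltac:(lia)); lia.
suff /key : x < (sort <=%R s)`_((size s)./2) by move=> /(_ ltac:(lia)); lia.
apply: contraTT h; rewrite -!leNgt => h.
have := @sort_nth_homo _ s (size s)./2.-1 (size s)./2 ltac:(lia) ltac:(lia).
lra.
Qed.

Lemma empirical_median_lt (R : realType) (s : seq R) (x : R) :
  empirical_median s < x -> (size s <= 2 * count (fun y => (y < x)%R) s)%N.
Proof.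
have [->|s0] := posnP (size s); first by rewrite leq0n.
have key j : (j < size s)%N -> (sort <=%R s)`_j < x ->
    (j < count (fun y : R => (y < x)%R) s)%N.
  by move=> js; rewrite sort_nth_lt.
rewrite /empirical_median; have sE := odd_double_half (size s).
case: ifPn => [os /key|os h]; first by move=> /(_ ltac:(lia)); move: (count _ s) => c; lia.
suff /key : (sort <=%R s)`_((size s)./2.-1) < x by move=> /(_ ltac:(lia)); move: (count _ s) => c; lia.
apply: contraTT h; rewrite -!leNgt => h.
have := @sort_nth_homo _ s (size s)./2.-1 (size s)./2 ltac:(lia) ltac:(lia).
lra.
Qed.

(** Finitely many yes/no observations cut the space into finitely many measurable cells, so [Q] may
    be any set of patterns. Counts, comparisons and survivor sets are all treated this way below. *)
Lemma measurable_finite_info (d : measure_display) (T : measurableType d)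
    (I : finType) (b : I -> T -> bool) (Q : set {ffun I -> bool}) :
  (forall i, measurable [set w | b i w]) ->
  measurable [set w | Q [ffun i => b i w]].
Proof.
move=> mb.
have -> : [set w | Q [ffun i => b i w]] =
    \bigcup_(f in Q) \bigcap_(i in [set: I]) [set w | b i w = f i].
  apply/seteqP; split => w /=; last first.
    move=> [f Qf /= bf]; suff -> : [ffun i => b i w] = f by [].
    by apply/ffunP => i; rewrite ffunE bf.
  by move=> Qw; exists [ffun i => b i w] => // i _ /=; rewrite ffunE.
apply: fin_bigcup_measurable => // f _.
apply: fin_bigcap_measurable => // i _.
case: (f i); first exact: mb.
have -> : [set w | b i w = false] = ~` [set w | b i w]; last exact: measurableC.
by apply/seteqP; split => w /=; [move=> ->|move/negP/negbTE].
Qed.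

Lemma count_mkseq (T : Type) (a : pred T) (f : nat -> T) (n : nat) :
  count a (mkseq f n) = (\sum_(i < n) a (f i))%N.
Proof.
rewrite -sum1_count big_map big_mkcond -[X in iota 0 X](subn0 n) -/(index_iota 0 n) big_mkord.
by apply: eq_bigr => i _; case: (a _).
Qed.

Lemma measurable_sort_nth (d : measure_display) (T : measurableType d)
    (R : realType) (X : nat -> T -> R) (n j : nat) :
  (forall s, measurable_fun setT (X s)) ->
  measurable_fun setT (fun w => (sort <=%R (mkseq (X^~ w) n))`_j).
Proof.
move=> mX; have [nj|jn] := leqP n j.
  rewrite (_ : (fun w => _) = cst 0); first exact: measurable_cst.
  by apply/funext => w; rewrite nth_default // size_sort size_mkseq.
move=> mT; apply: (measurability _ (RGenInftyO.measurableE R)) => // _ [_ [x ->] <-].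
rewrite setTI.
(* The order statistic lies below [x] when more than [j] samples do, an event decided by the [n]
   comparisons with [x]. *)
have -> : (fun w => (sort <=%R (mkseq (X^~ w) n))`_j) @^-1` `]-oo, x[ =
    [set w | [set f : {ffun 'I_n -> bool} | (j < \sum_(i < n) f i)%N]
               [ffun i : 'I_n => X i w < x]].
  apply/seteqP; split => w /=; rewrite in_itv /= sort_nth_lt ?size_mkseq // count_mkseq;
    by under eq_bigr do rewrite ffunE.
apply: measurable_finite_info => i.
have -> : [set w | X i w < x] = X i @^-1` `]-oo, x[.
  by apply/seteqP; split => w /=; rewrite in_itv.
by rewrite -[_ @^-1` _]setTI; apply: mX.
Qed.

Lemma measurable_empirical_median (d : measure_display) (T : measurableType d)
    (R : realType) (X : nat -> T -> R) (n : nat) :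
  (forall s, measurable_fun setT (X s)) ->
  measurable_fun setT (fun w => empirical_median (mkseq (X^~ w) n)).
Proof.
move=> mX; rewrite /empirical_median.
under [X in measurable_fun _ X]funext do rewrite size_mkseq.
case: (odd n); first exact: measurable_sort_nth.
apply: measurable_funM; last exact: measurable_cst.
by apply: measurable_funD; exact: measurable_sort_nth.
Qed.

Lemma measure_union_bound (d : measure_display) (T : measurableType d) (R : realType)
    (P : probability T R) (I : finType) (D : pred I) (A : set T) (F : I -> set T) :
  measurable A -> (forall i, measurable (F i)) ->
  A `<=` \bigcup_(i in [set i | D i]) F i -> (P A <= \sum_(i | D i) P (F i))%E.
Proof.
move=> mA mF AF; rewrite -big_filter fsbig_seq ?filter_uniq ?index_enum_uniq //.
apply: content_sub_fsum => // w /AF[i /= Di Fi].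
by exists i => //=; rewrite mem_filter Di mem_index_enum.
Qed.

(** * Chernoff bound for a majority of independent events *)

(** The tilt is the minimiser l = ln (b / a), where a and b are the square roots of 1/2 - eta and
    1/2 + eta. The minimum is 2ab = sqrt (1 - 4 eta^2), and squaring reduces the claim to 1 + y <=
    exp y. *)
Lemma bernoulli_tilt (R : realType) (eta : R) : 0 <= eta < 2^-1 ->
  exists2 l : R, 0 <= l &
    (2^-1 - eta) * expR l + (2^-1 + eta) * expR (- l) <= expR (- (2 * eta ^+ 2)).
Proof.
move=> /andP[eta0 eta2].
have a0 : 0 < Num.sqrt (2^-1 - eta) by rewrite sqrtr_gt0; lra.
have b0 : 0 < Num.sqrt (2^-1 + eta) by rewrite sqrtr_gt0; lra.
have a2 : Num.sqrt (2^-1 - eta) ^+ 2 = 2^-1 - eta by rewrite sqr_sqrtr; lra.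
have b2 : Num.sqrt (2^-1 + eta) ^+ 2 = 2^-1 + eta by rewrite sqr_sqrtr; lra.
have ab : Num.sqrt (2^-1 - eta) <= Num.sqrt (2^-1 + eta) by rewrite ler_wsqrtr; lra.
move: (Num.sqrt (2^-1 - eta)) (Num.sqrt (2^-1 + eta)) a0 b0 a2 b2 ab => a b a0 b0 a2 b2 ab.
exists (ln (b / a)); first by rewrite ln_ge0 // ler_pdivlMr // mul1r.
rewrite expRN lnK ?posrE ?divr_gt0 // -a2 -b2.
have -> : a ^+ 2 * (b / a) + b ^+ 2 * (b / a)^-1 = 2 * (a * b).
  by field; rewrite !gt_eqF.
rewrite -(@ler_pXn2r _ 2) ?nnegrE ?expR_ge0 //; last by nra.
rewrite -expRM_natr; apply: le_trans (expR_ge1Dx _).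
rewrite exprMn exprMn a2 b2; lra.
Qed.

(** Chernoff's argument on finite sums: each 0/1 pattern has a product probability, patterns with a
    majority get a tilting weight of at least 1, and the weighted sum over all patterns
    factorizes. *)
Lemma majority_bound (d : measure_display) (T : measurableType d) (R : realType)
    (P : probability T R) (d' : measure_display) (E : measurableType d')
    (W : nat -> T -> E) (A : set E) (n : nat) (eta : R) :
  (forall t, measurable_fun setT (W t)) -> measurable A ->
  independent_seq P W -> 0 <= eta < 2^-1 ->
  (forall t, (P (W t @^-1` A) <= (2^-1 - eta)%:E)%E) ->
  (P [set w | (n <= 2 * \sum_(t < n) (W t w \in A))%N] <=
    (expR (- (2 * eta ^+ 2)) ^+ n)%:E)%E.
Proof.
move=> mW mA indep eta12 pA; have [l l0 tilt] := bernoulli_tilt eta12.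
have mWA (B : set E) t : measurable B -> measurable (W t @^-1` B).
  by move=> mB; rewrite -[_ @^-1` _]setTI; apply: mW.
pose p t := fine (P (W t @^-1` A)).
have pE t : P (W t @^-1` A) = (p t)%:E by rewrite fineK // fin_num_measure //; exact: mWA.
have p0 t : 0 <= p t by rewrite fine_ge0 // measure_ge0.
have p1 t : 0 <= 1 - p t by rewrite subr_ge0 -lee_fin -pE probability_le1 //; exact: mWA.
pose q t b := if b then p t else 1 - p t.
have q0 t b : 0 <= q t b by rewrite /q; case: b.
pose S b := if b then A else ~` A.
have mS b : measurable (S b) by case: b => //; exact: measurableC.
have PS t b : fine (P (W t @^-1` S b)) = q t b.
  case: b => //=; rewrite preimage_setC probability_setC ?pE //; exact: mWA.
(* Independence is stated for families indexed by all of [nat]; the default [true] beyond [n] is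
   never read. *)
pose ext (f : {ffun 'I_n -> bool}) t := if insub t is Some i then f i else true.
have extE f (i : 'I_n) : ext f i = f i by rewrite /ext valK.
pose pat f := [set w | forall t, t \in iota 0 n -> S (ext f t) (W t w)].
have Ppat f : P (pat f) = (\prod_(i < n) q i (f i))%:E.
  rewrite /pat (indep _ (fun t => S (ext f t))) ?iota_uniq //.
  rewrite -[X in iota 0 X](subn0 n) -/(index_iota 0 n) big_mkord.
  by under eq_bigr do rewrite PS extE.
have mpat f : measurable (pat f).
  have -> : pat f = \bigcap_(t in [set` iota 0 n]) W t @^-1` S (ext f t) by [].
  by apply: fin_bigcap_measurable => // t _; exact: mWA.
pose maj (f : {ffun 'I_n -> bool}) := (n <= 2 * \sum_(t < n) f t)%N.
have majE w : maj [ffun i : 'I_n => W i w \in A] = (n <= 2 * \sum_(t < n) (W t w \in A))%N.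
  by rewrite /maj; under eq_bigr do rewrite ffunE.
have mev : measurable [set w | (n <= 2 * \sum_(t < n) (W t w \in A))%N].
  have -> : [set w | (n <= 2 * \sum_(t < n) (W t w \in A))%N] =
     [set w | [set f | maj f] [ffun i : 'I_n => W i w \in A]].
    by apply/seteqP; split => w /=; rewrite majE.
  apply: measurable_finite_info => i.
  have -> : [set w | W i w \in A] = W i @^-1` A; last exact: mWA.
  by apply/seteqP; split => w /=; rewrite inE.
apply: le_trans (measure_union_bound (D := maj) (F := pat) _ _ mpat _) _ => //.
  move=> w /= h; exists [ffun i : 'I_n => W i w \in A].
    by rewrite /= majE.
  move=> t; rewrite mem_iota add0n /= => tn.
  rewrite (extE _ (Ordinal tn)) ffunE /=.
  by case: (boolP (W t w \in A)) => /=; rewrite ?inE // => /negP; rewrite inE.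
under eq_bigr do rewrite Ppat.
rewrite sumEFin lee_fin.
pose s (b : bool) := if b then l else - l.
(* With at least half of the entries true, the sum of the signs times [l] is nonnegative. *)
have ge1 f : maj f -> 1 <= \prod_(i < n) expR (s (f i)).
  move=> mf; rewrite -expR_sum -expR0 ler_expR.
  have -> : \sum_(i < n) s (f i) = \sum_(i < n) (2 * l * (f i)%:R - l).
    by apply: eq_bigr => i _; rewrite /s; case: (f i) => /=; ring.
  rewrite sumrB -mulr_sumr -natr_sum sumr_const card_ord -mulr_natr.
  have : n%:R <= (2 * \sum_(i < n) f i)%N%:R :> R by rewrite ler_nat.
  rewrite natrM; nra.
apply: (@le_trans _ _ (\sum_(f : {ffun 'I_n -> bool}) \prod_(i < n) (q i (f i) * expR (s (f i))))).
  rewrite [leRHS](bigID maj) /= -[leLHS]addr0; apply: lerD; last first.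
    by apply: sumr_ge0 => f _; apply: prodr_ge0 => i _; rewrite mulr_ge0 ?expR_ge0.
  apply: ler_sum => f mf; rewrite big_split /= ler_peMr ?ge1 //.
  by apply: prodr_ge0.
rewrite -(bigA_distr_bigA (fun (i : 'I_n) b => q i b * expR (s b))) /=.
rewrite -[X in _ <= _ ^+ X]card_ord -prodr_const.
apply: ler_prod => i _; rewrite big_bool /= /q /s.
have := pA i; rewrite pE lee_fin => pi.
rewrite addr_ge0 ?mulr_ge0 ?expR_ge0 //=; apply: le_trans tilt.
(* The tilted factor is increasing in the success probability, so that probability may be replaced
   by its bound 1/2 - eta. *)
have : expR (- l) <= expR l by rewrite ler_expR; lra.
move: (p0 i) pi; nra.
Qed.

(** * Cumulative distribution functions in the family *)

Section cdf.
Context {R : realType} (F : probability R R).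

Lemma cdfRE x : F `]-oo, x]%classic = (cdfR F x)%:E.
Proof. by rewrite /cdfR fineK // fin_num_measure. Qed.

Lemma cdfR_le x y : x <= y -> cdfR F x <= cdfR F y.
Proof.
move=> xy; rewrite -lee_fin -!cdfRE; apply: le_measure; rewrite ?inE //.
by apply: subset_itvl; rewrite bnd_simp.
Qed.

Lemma measure_itv_oinfty x : F `]x, +oo[%classic = (1 - cdfR F x)%:E.
Proof. by rewrite -setCitvl probability_setC // EFinB cdfRE. Qed.

Lemma measure_itv_oo_le x : (F `]-oo, x[%classic <= (cdfR F x)%:E)%E.
Proof.
rewrite -cdfRE; apply: le_measure; rewrite ?inE //.
by apply: subset_itvl; rewrite bnd_simp.
Qed.

(** The identity is a random variable with law [F], which gives access to the limits of [cdf] at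
    both infinities. *)
Let idTR : R -> R := idfun.

#[local] HB.instance Definition _ :=
  @isMeasurableFun.Build _ _ R R idTR (@measurable_id _ R setT).

Let cdf_idTR : fine \o cdf (idTR : {RV F >-> R}) = cdfR F.
Proof. by apply/funext => x. Qed.

(** This makes the sets behind the quantiles nonempty, and [cdfR_small] bounds them below, so that
    [QL] and [QR] are genuine infima and not default values. *)
Lemma cdfR_large p : p < 1 -> exists x, p < cdfR F x.
Proof.
move=> p1; have F1 : cdfR F @ +oo --> (1 : R) by rewrite -cdf_idTR; exact/fine_cvg/cvg_cdfy1.
have F1p : \forall x \near +oo, p < cdfR F x by exact: (cvgr_gt _ F1).
exact: (filter_ex F1p).
Qed.

Lemma cdfR_small p : 0 < p -> exists x, cdfR F x < p.
Proof.
move=> p0; have F0 : cdfR F @ -oo --> (0 : R) by rewrite -cdf_idTR; exact/fine_cvg/cvg_cdfNy0.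
have F0p : \forall x \near -oo, cdfR F x < p by exact: (cvgr_lt _ F0).
exact: (filter_ex F0p).
Qed.

Lemma median_lower m x : is_median F m -> x < m -> cdfR F x <= 2^-1.
Proof.
move=> [_ h] xm; suff : 2^-1 <= 1 - cdfR F x by lra.
rewrite -lee_fin -measure_itv_oinfty; apply: le_trans h _.
by apply: le_measure; rewrite ?inE //; apply: subset_itvr; rewrite bnd_simp.
Qed.

Lemma median_upper m : is_median F m -> 2^-1 <= cdfR F m.
Proof. by move=> [h _]; rewrite -lee_fin -cdfRE. Qed.

Lemma lt_QL p x : x < QL F p -> 0 < p -> cdfR F x < p.
Proof.
move=> + p0; apply: contraTT; rewrite -!leNgt => px.
apply: ge_inf => //; have [y yp] := cdfR_small p0; exists y => z /= pz.
by rewrite leNgt; apply/negP => /ltW/cdfR_le; lra.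
Qed.

Lemma QR_lt p x : QR F p < x -> p < 1 -> p < cdfR F x.
Proof.
move=> + p1 => /inf_lt-/(_ (cdfR_large p1))[y /= py yx].
by apply: lt_le_trans py _; apply: cdfR_le; exact: ltW.
Qed.

Lemma median_quantile_range m t : is_median F m -> 0 < t < 2^-1 ->
  QL F (2^-1 - t) <= m <= QR F (2^-1 + t).
Proof.
move=> mm /andP[t0 t2]; have mu := median_upper mm; apply/andP; split.
  by rewrite leNgt; apply/negP => /lt_QL; lra.
apply: lb_le_inf => [|x /= tx]; first by apply: cdfR_large; lra.
by rewrite leNgt; apply/negP => /(median_lower mm); lra.
Qed.

Variables (tbar B m1 m2 : R).
Hypotheses (FF : in_family tbar B F m1 m2) (B0 : 0 < B) (tbar12 : 0 < tbar < 2^-1).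

(** Inside the quantile range the slope condition between the median and [x] gives the linear term;
    to the right of the range the cdf already exceeds 1/2 + tbar. *)
Lemma family_cdfR_ge x : m1 <= x ->
  2^-1 + Num.min tbar ((x - m1) / (B * m2)) <= cdfR F x.
Proof.
case: FF => -[mm _] _ m20 sep xm1; have mR := median_quantile_range mm tbar12.
have /andP[QLm QRm] := mR; have /andP[t0 t2] := tbar12.
have minl : Num.min tbar ((x - m1) / (B * m2)) <= tbar by rewrite ge_min lexx.
have minr : Num.min tbar ((x - m1) / (B * m2)) <= (x - m1) / (B * m2).
  by rewrite ge_min lexx orbT.
have [xR|Rx] := leP x (QR F (2^-1 + tbar)); last first.
  have /QR_lt := Rx => /(_ ltac:(lra)); lra.
have xI : QL F (2^-1 - tbar) <= x <= QR F (2^-1 + tbar) by apply/andP; split; lra.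
have := sep _ _ xI mR; rewrite ger0_norm ?subr_ge0 // ger0_norm ?subr_ge0 ?cdfR_le //.
rewrite mulrC => h; have := median_upper mm.
lra.
Qed.

(** Not a mirror image of the previous bound: [F] may jump at the median, so the slope condition
    between [x] and [m1] says nothing about the distance of F(x) from 1/2. It is applied instead at
    a point strictly below [m1], where the cdf is still at most 1/2. *)
Lemma family_cdfR_le x : x < m1 ->
  cdfR F x <= 2^-1 - Num.min tbar ((m1 - x) / (B * m2)).
Proof.
case: FF => -[mm _] _ m20 sep xm1; have mR := median_quantile_range mm tbar12.
have /andP[QLm QRm] := mR; have /andP[t0 t2] := tbar12.
have minl : Num.min tbar ((m1 - x) / (B * m2)) <= tbar by rewrite ge_min lexx.
have minr : Num.min tbar ((m1 - x) / (B * m2)) <= (m1 - x) / (B * m2).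
  by rewrite ge_min lexx orbT.
have [Lx|xL] := leP (QL F (2^-1 - tbar)) x; last first.
  have /lt_QL := xL => /(_ ltac:(lra)); lra.
suff : (m1 - x) / (B * m2) <= 2^-1 - cdfR F x by lra.
have c0 : 0 < B * m2 by rewrite mulr_gt0.
rewrite ler_pdivrMr //; rewrite leNgt; apply/negP => gap.
(* the midpoint of x + B m2 (1/2 - F x) and m1 contradicts the separation *)
pose y := (m1 + x + (2^-1 - cdfR F x) * (B * m2)) / 2.
have D0 : 0 <= (2^-1 - cdfR F x) * (B * m2).
  by apply: mulr_ge0; [rewrite subr_ge0; exact: median_lower xm1|exact: ltW].
have xy : x < y by rewrite /y; lra.
have ym : y < m1 by rewrite /y; lra.
have xI : QL F (2^-1 - tbar) <= x <= QR F (2^-1 + tbar) by apply/andP; split; lra.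
have yI : QL F (2^-1 - tbar) <= y <= QR F (2^-1 + tbar) by apply/andP; split; lra.
have := sep _ _ yI xI; rewrite ger0_norm ?subr_ge0 ?(ltW xy) //.
rewrite ger0_norm ?subr_ge0 ?cdfR_le ?(ltW xy) // mulrC ler_pdivrMr //.
have := median_lower mm ym; rewrite -(ler_pM2r c0) /y; lra.
Qed.

End cdf.

(** * Contaminated samples *)

Lemma independent_seq_comp (d : measure_display) (T : measurableType d) (R : realType)
    (P : probability T R) (d1 d2 : measure_display) (E1 : measurableType d1)
    (E2 : measurableType d2) (W : nat -> T -> E1) (h : E1 -> E2) :
  measurable_fun setT h -> independent_seq P W ->
  independent_seq P (fun s w => h (W s w)).
Proof.
move=> mh iW J A uJ mA.
apply: (iW J (fun t => h @^-1` A t) uJ) => t.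
by rewrite -[_ @^-1` _]setTI; apply: mh.
Qed.

Section contamination.
Context {R : realType} {d : measure_display} {T : measurableType d}.
Context (P : probability T R) (adv : adversary) (k : nat) (eps : R).
Context (F : 'I_k -> probability R R).
Context (Y : 'I_k -> nat -> {RV P >-> R}) (D : 'I_k -> nat -> {RV P >-> bool}).
Context (Z : 'I_k -> nat -> {RV P >-> R}).
Hypotheses (cont : contaminated_by adv eps F Y D Z) (eps12 : 0 < eps < 2^-1).

(** The contamination value is left out: for all three adversaries, these pairs are independent
    across the pulls of an arm. *)
Definition clean_pair (i : 'I_k) (s : nat) (w : T) : R * bool := (Y i s w, D i s w).

Lemma measurable_clean_pair i s : measurable_fun setT (clean_pair i s).
Proof. by apply: measurable_fun_pair; exact: measurable_funPT. Qed.

Lemma clean_pair_independent i : independent_seq P (clean_pair i).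
Proof.
have [_ _ h _] := cont i; rewrite /clean_pair; move: h; case: (adv) => h; [|exact: h|exact: h].
exact: (independent_seq_comp (@measurable_fst _ _ _ _) h).
Qed.

Definition spoiled (C : set R) : set (R * bool) := [set yb : R * bool | C yb.1 \/ yb.2 = true].

Lemma measurable_spoiled C : measurable C -> measurable (spoiled C).
Proof.
move=> mC; have -> : spoiled C = (C `*` setT) `|` (setT `*` [set true]).
  apply/seteqP; split => -[y b] /=; rewrite /spoiled /=; tauto.
by apply: measurableU; apply: measurableX.
Qed.

(** For the malicious adversary this is the union bound F(C) + eps. Otherwise a sample is unspoiled
    with probability (1 - F(C)) (1 - eps), and [eff_eps] is the value e with (1 - eps) (1/2 + e) =
    1/2; the margin left is (1 - eps) h >= h / 2. *)
Lemma spoiled_prob i s C h : measurable C -> 0 <= h ->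
  (F i C <= (2^-1 - (eff_eps adv eps + h))%:E)%E ->
  (P (clean_pair i s @^-1` spoiled C) <= (2^-1 - h / 2)%:E)%E.
Proof.
move=> mC h0; have [YF DB _ YD] := cont i; have [e0 e2] := andP eps12.
have mY A : measurable A -> measurable (Y i s @^-1` A).
  by move=> mA; rewrite -[_ @^-1` _]setTI; exact: measurable_funPT.
have mD A : measurable (D i s @^-1` A).
  by rewrite -[_ @^-1` _]setTI; exact: measurable_funPT.
have PY A : measurable A -> P (Y i s @^-1` A) = F i A by move=> mA; rewrite -(YF s).
have PD A : P (D i s @^-1` A) = bernoulli_prob eps A by rewrite -(DB s).
have e01 : 0 <= eps <= 1 by apply/andP; split; lra.
have bt : bernoulli_prob eps [set true] = eps%:E by rewrite /bernoulli_prob e01 fsbig_set1.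
have bf : bernoulli_prob eps [set false] = (1 - eps)%:E by rewrite /bernoulli_prob e01 fsbig_set1.
have FC : F i C = (fine (F i C))%:E by rewrite fineK // fin_num_measure.
rewrite FC lee_fin => hC.
have Un : clean_pair i s @^-1` spoiled C = Y i s @^-1` C `|` D i s @^-1` [set true].
  by [].
have mal : eff_eps adv eps = eps -> (P (clean_pair i s @^-1` spoiled C) <= (2^-1 - h / 2)%:E)%E.
  move=> ee; rewrite Un; apply: le_trans (measureU2 _ _ _) _; [exact: mY|exact: mD|].
  rewrite [X in (X + _)%E]PY // [X in (_ + X)%E]PD bt FC -EFinD lee_fin.
  by rewrite ee in hC; lra.
have ind : (forall s, independent_pair P (Y i s) (D i s)) ->
    eff_eps adv eps = eps / (2 * (1 - eps)) ->
    (P (clean_pair i s @^-1` spoiled C) <= (2^-1 - h / 2)%:E)%E.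
  move=> /(_ s (~` C) [set false] (measurableC mC) I) YDi ee.
  have -> : clean_pair i s @^-1` spoiled C =
      ~` (Y i s @^-1` (~` C) `&` D i s @^-1` [set false]).
    rewrite Un setCI -!preimage_setC setCK; congr (_ `|` _).
    by apply/seteqP; split => w /=; case: (D i s w).
  rewrite probability_setC; last by apply: measurableI; [apply: mY; exact: measurableC|exact: mD].
  rewrite YDi PY; last exact: measurableC.
  rewrite PD bf probability_setC // FC.
  rewrite -[leLHS]/((1 - (1 - fine (F i C)) * (1 - eps))%:E) lee_fin.
  have : (1 - eps) * fine (F i C) <= (1 - eps) * (2^-1 - (eff_eps adv eps + h)).
    by rewrite ler_pM2l //; lra.
  have : (1 - eps) * eff_eps adv eps = eps / 2 by rewrite ee; field; lra.
  nra.
by move: YD mal ind {hC}; case: (adv) => /= YD mal ind; auto.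
Qed.

(* The deviation [a] splits into the unavoidable bias, absorbed by [eff_eps],
   and the statistical fluctuation, controlled by the number of samples. *)
Lemma spoiled_majority (i : 'I_k) (C : set R) (n : nat) (tbar a L : R) :
  measurable C -> eff_eps adv eps < tbar < 2^-1 -> 0 <= a ->
  (F i C <= (2^-1 - Num.min tbar (eff_eps adv eps + a))%:E)%E ->
  sample_factor adv eps tbar * L <= n%:R -> 2 * L <= a ^+ 2 * n%:R ->
  (P [set w | (n <= 2 * \sum_(t < n) (clean_pair i t w \in spoiled C))%N] <=
    (expR (- L))%:E)%E.
Proof.
move=> mC tb a0 FC nN na; have [et t2] := andP tb.
pose h := Num.min (tbar - eff_eps adv eps) a.
have ee0 : 0 < eff_eps adv eps.
  have [e0 e2] := andP eps12.
  by case: (adv) => //=; rewrite divr_gt0 // mulr_gt0 //; lra.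
have h0 : 0 <= h by rewrite le_min a0 andbT; lra.
have h1 : h <= tbar - eff_eps adv eps by rewrite ge_min lexx.
have hE : Num.min tbar (eff_eps adv eps + a) = eff_eps adv eps + h.
  by rewrite /h addr_minr; congr (Num.min _ _); ring.
rewrite hE in FC.
(* Each branch of the minimum uses one of the two lower bounds on [n]: the factor N covers tbar -
   eff_eps, the other covers [a]. *)
have h2 : 2 * L <= h ^+ 2 * n%:R.
  rewrite /h minEle; case: ifP => _ //.
  move: nN; rewrite /sample_factor mulrAC ler_pdivrMr; first by rewrite [n%:R * _]mulrC.
  by rewrite exprn_gt0 // subr_gt0.
(* With eta = h / 2 the Chernoff exponent is h^2 n / 2, which is at least [L]. *)
apply: le_trans (majority_bound n (measurable_clean_pair i) (measurable_spoiled mC)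
  (@clean_pair_independent i) _ (fun t => spoiled_prob t mC h0 FC)) _.
  by apply/andP; split; lra.
rewrite lee_fin -expRM_natr ler_expR; lra.
Qed.

End contamination.

(** * Pull counts and elimination rounds *)

Section numeric.
Context {R : realType}.
Implicit Types (x : R).

Lemma norm_sin_le x : 0 <= x -> `|sin x| <= x.
Proof.
move=> x0; have cs : {within `[0, x], continuous (@sin R)}.
  by apply: continuous_subspaceT => ?; exact: continuous_sin.
have [c _ h] := MVT_segment x0 (fun y _ => is_derive_sin y) cs.
move: h; rewrite sin0 !subr0 => ->.
by rewrite normrM (ger0_norm x0) ler_piMl // cos_max.
Qed.

(** The double angle formula at pi / 4 gives sin^2 (pi / 4) = 1/2, and sin x <= x. Together with the
    bound 2 on the sum of inverse squares, this suffices for the union bound without the exact value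
    pi^2 / 6. *)
Lemma pi_sqr_ge8 : 8 <= pi ^+ 2 :> R.
Proof.
have := cos_mulr2n (pi / 4 : R); have -> : (pi / 4 : R) *+ 2 = pi / 2 by field.
rewrite cos_pihalf cos2sin2 => h.
have p0 : 0 <= pi / 4 :> R by rewrite divr_ge0 ?pi_ge0.
have := norm_sin_le p0; rewrite -(@ler_pXn2r _ 2) ?nnegrE // real_normK ?num_real //.
rewrite mulr2n in h; rewrite expr_div_n; lra.
Qed.

Lemma sum_inv_sqr_le2 n : \sum_(r < n) (r.+1%:R ^+ 2)^-1 <= 2 :> R.
Proof.
have [->|n0] := posnP n; first by rewrite big_ord0.
(* The stronger bound 2 - 1/n is inductive, because 1 / (n + 1)^2 <= 1/n - 1/(n + 1). *)
suff : \sum_(r < n) (r.+1%:R ^+ 2)^-1 <= 2 - n%:R^-1 :> R.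
  by move/le_trans; apply; rewrite gerBl invr_ge0.
case: n n0 => // n _; elim: n => [|n IH]; first by rewrite big_ord1 /= expr1n invr1; lra.
rewrite big_ord_recr /=; apply: le_trans (lerD IH (lexx _)) _.
rewrite -[n.+2%:R]natr1; have : 0 < n.+1%:R :> R by rewrite ltr0n.
move: (n.+1%:R) => a a0; rewrite -subr_ge0.
have -> : 2 - (a + 1)^-1 - (2 - a^-1 + ((a + 1) ^+ 2)^-1) = (a * (a + 1) ^+ 2)^-1.
  by field; lra.
by rewrite invr_ge0 mulr_ge0 ?exprn_ge0; lra.
Qed.

Lemma ceil_nat_ge x : x <= (ceil_nat x)%:R.
Proof.
apply: le_trans (ceil_ge x) _; rewrite /ceil_nat -[X in _ <= X]mulr1n natr_absz.
by rewrite ler_int ler_norm.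
Qed.

Lemma ceil_nat_le x : 0 <= x -> (ceil_nat x)%:R <= x + 1.
Proof.
move=> x0; rewrite /ceil_nat natr_absz ger0_norm; last by rewrite ceil_ge0; lra.
by have /andP[+ _] := ceil_itv x; rewrite intrB; lra.
Qed.

Lemma ln2_ge : 2^-1 <= ln 2 :> R.
Proof.
have := @le_ln1Dx R (- 2^-1) ltac:(lra).
have -> : 1 + - 2^-1 = 2^-1 :> R by lra.
rewrite lnV ?posrE //; lra.
Qed.

Lemma ln2_le : ln 2 <= 1 :> R.
Proof. by have := @le_ln1Dx R 1 ltac:(lra). Qed.

End numeric.

Section pull_count.
Context {R : realType} (k : nat) (N delta : R).
Hypotheses (k2 : (2 <= k)%N) (N8 : 8 <= N) (delta01 : 0 < delta < 1).

(** Total pulls of an arm that is still active when its median is taken in round [r]; [r = 0] is the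
    initial sampling phase. *)
Definition pull_count (r : nat) : nat :=
  (ceil_nat (N * ln (pi ^+ 2 * k%:R / (2 * delta))) +
   \sum_(1 <= s < r.+1) (1 + ceil_nat (2 * N * ln (s.+1%:R / s%:R))))%N.

(** This is ln (3 / delta') at the level delta' = 6 delta / (pi^2 k r^2) used in round [r]. *)
Definition conf_log (r : nat) : R := ln (pi ^+ 2 * k%:R * r%:R ^+ 2 / (2 * delta)).

Let d0 : 0 < delta. Proof. by case/andP: delta01. Qed.
Let k2R : 2 <= k%:R :> R. Proof. by rewrite ler_nat. Qed.

Lemma kdelta_ge2 : 2 <= k%:R / delta.
Proof. by rewrite ler_pdivlMr //; case/andP: delta01 => _ d1; have := k2R; lra. Qed.

Lemma conf_arg_ge1 : 1 <= pi ^+ 2 * k%:R / (2 * delta).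
Proof.
have -> : pi ^+ 2 * k%:R / (2 * delta) = pi ^+ 2 / 2 * (k%:R / delta).
  by field; rewrite gt_eqF.
have := kdelta_ge2; have := @pi_sqr_ge8 R; nra.
Qed.

Lemma conf_logE r : (0 < r)%N ->
  conf_log r = ln (pi ^+ 2 * k%:R / (2 * delta)) + 2 * ln r%:R.
Proof.
move=> r0; rewrite /conf_log.
have -> : pi ^+ 2 * k%:R * r%:R ^+ 2 / (2 * delta) =
  pi ^+ 2 * k%:R / (2 * delta) * r%:R ^+ 2 by field; rewrite gt_eqF.
have a1 := conf_arg_ge1.
rewrite lnM ?posrE ?exprn_gt0 ?ltr0n //; last by lra.
by rewrite lnXn ?ltr0n //; congr (_ + _); rewrite mulr_natl.
Qed.

Lemma conf_log_ge0 r : (0 < r)%N -> 0 <= conf_log r.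
Proof.
move=> r0; rewrite conf_logE // addr_ge0 ?ln_ge0 ?conf_arg_ge1 //.
by rewrite mulr_ge0 // ln_ge0 // ler1n.
Qed.

Lemma sum_ln_ratio r : \sum_(1 <= s < r.+1) ln (s.+1%:R / s%:R) = ln r.+1%:R :> R.
Proof.
have lnq s : (0 < s)%N -> ln (s.+1%:R / s%:R) = ln s.+1%:R - ln s%:R :> R.
  by move=> s0; rewrite ln_div ?posrE ?ltr0n.
rewrite (eq_big_nat _ _ (F2 := fun s => ln s.+1%:R - ln s%:R)); last first.
  by move=> s /andP[s1 _]; exact: lnq.
by rewrite telescope_sumr // ln1 subr0.
Qed.

Lemma ln_ratio_ge0 s : (0 < s)%N -> 0 <= ln (s.+1%:R / s%:R) :> R.
Proof.
by move=> s0; rewrite ln_ge0 // ler_pdivlMr ?ltr0n // mul1r ler_nat.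
Qed.

Lemma pull_count_ge_round r : (r <= pull_count r)%N.
Proof.
rewrite /pull_count big_split /= sum_nat_const_nat subn1 /= muln1.
by rewrite addnCA leq_addr.
Qed.

(** The initial phase pays for the part of [conf_log] free of [r]; the increments of the rounds
    telescope to 2 N ln (r + 1), which pays for 2 N ln r. *)
Lemma pull_count_ge r : (0 < r)%N -> N * conf_log r <= (pull_count r)%:R.
Proof.
move=> r0; rewrite conf_logE // /pull_count natrD mulrDr; apply: lerD; first exact: ceil_nat_ge.
rewrite natr_sum; apply: (@le_trans _ _ (\sum_(1 <= s < r.+1) 2 * N * ln (s.+1%:R / s%:R))).
  rewrite -mulr_sumr sum_ln_ratio mulrA [N * 2]mulrC; apply: ler_wpM2l; first by have := N8; lra.
  by rewrite ler_ln ?posrE ?ltr0n // ler_nat.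
by apply: ler_sum => s _; rewrite natrD; apply: le_trans (ceil_nat_ge _) _; rewrite lerDr.
Qed.

(** The term 2 r collects, for each round, the one extra pull and at most one more from rounding
    up. *)
Lemma pull_count_le r : (pull_count r)%:R <=
  1 + N * ln (pi ^+ 2 * k%:R / (2 * delta)) + 2 * r%:R + 2 * N * ln r.+1%:R.
Proof.
have N0 : 0 <= N by have := N8; lra.
rewrite /pull_count natrD -addrA; apply: lerD.
  by rewrite addrC; apply: ceil_nat_le; rewrite mulr_ge0 ?ln_ge0 ?conf_arg_ge1.
rewrite natr_sum; apply: (@le_trans _ _ (\sum_(1 <= s < r.+1) (2 + 2 * N * ln (s.+1%:R / s%:R)))).
  apply: ler_sum_nat => s /andP[s1 _]; rewrite natrD.
  have := ceil_nat_le (mulr_ge0 (mulr_ge0 (ler0n R 2) N0) (ln_ratio_ge0 s1)); lra.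
rewrite big_split /= sumr_const_nat subn1 /= -mulr_sumr sum_ln_ratio.
by rewrite mulr_natr.
Qed.

End pull_count.

Lemma alpha_ge0 (R : realType) (B m2bar : R) r delta' : 0 <= alpha B m2bar r delta'.
Proof. exact: sqrtr_ge0. Qed.

Lemma alpha_conf_log (R : realType) (B m2bar delta : R) (k r : nat) :
  (2 <= k)%N -> 0 < delta < 1 -> (0 < r)%N ->
  alpha B m2bar r (6 * delta / (pi ^+ 2 * k%:R * r%:R ^+ 2)) ^+ 2 =
  2 * B ^+ 2 * m2bar ^+ 2 * conf_log k delta r / r%:R.
Proof.
move=> k2 delta01 r0; have d0 : 0 < delta by case/andP: delta01.
have k0 : 0 < k%:R :> R by rewrite ltr0n; exact: leq_trans k2.
have rR : 0 < r%:R :> R by rewrite ltr0n.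
have -> : alpha B m2bar r (6 * delta / (pi ^+ 2 * k%:R * r%:R ^+ 2)) =
    Num.sqrt (2 * B ^+ 2 * m2bar ^+ 2 * conf_log k delta r / r%:R).
  rewrite /alpha /conf_log; congr (Num.sqrt (_ * ln _ / _)).
  by move: (@pi R) (@pi_gt0 R) => p p0; field; rewrite !gt_eqF.
rewrite sqr_sqrtr // divr_ge0 ?ler0n // mulr_ge0 ?conf_log_ge0 //.
by rewrite mulr_ge0 ?sqr_ge0 // mulr_ge0 ?sqr_ge0.
Qed.

Section elimination_round.
Context {R : realType}.

(** Keeps the logarithm away from 0, so that additive constants can be absorbed into multiples of
    it. *)
Lemma log_term_ge (k : nat) (delta g : R) : (2 <= k)%N -> 0 < delta < 1 -> 0 < g ->
  2^-1 <= log_term k delta g.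
Proof.
move=> k2 delta01 g0; have kd := kdelta_ge2 k2 delta01.
have d0 : 0 < delta by case/andP: delta01.
apply: le_trans ln2_ge _; rewrite ler_ln ?posrE //; last first.
  by rewrite divr_gt0 ?ltr0n ?(leq_trans _ k2) // mulr_gt0 // lt_min g0 ltr01.
apply: le_trans kd _; rewrite ler_pM2l ?ltr0n ?(leq_trans _ k2) //.
rewrite lef_pV2 ?posrE ?mulr_gt0 // ?lt_min ?g0 ?ltr01 //.
by rewrite ler_piMr ?(ltW d0) // ge_min lexx.
Qed.

(* [conf_log] at a round of order [L / g ^ 2] is still linear in [L]: the
   double logarithm is absorbed by [ln y <= y]. *)
Lemma conf_log_le (k r : nat) (delta g s : R) :
  (2 <= k)%N -> 0 < delta < 1 -> 0 < g -> 2 <= s -> (0 < r)%N ->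
  r%:R <= 2 * (s ^+ 2 * log_term k delta g / Num.min 1 g ^+ 2) ->
  conf_log k delta r <= (24 * s + 6) * log_term k delta g.
Proof.
move=> k2 delta01 g0 s2 r0 rle; have kd := kdelta_ge2 k2 delta01.
have Lge := log_term_ge k2 delta01 g0; have d0 : 0 < delta by case/andP: delta01.
have m0 : 0 < Num.min 1 g by rewrite lt_min g0 ltr01.
have m1 : Num.min 1 g <= 1 by rewrite ge_min lexx.
have eL : expR (log_term k delta g) = k%:R / delta / Num.min 1 g.
  rewrite /log_term lnK; first by rewrite invfM mulrA.
  by rewrite posrE divr_gt0 ?mulr_gt0 // ltr0n (leq_trans _ k2).
move: (log_term _ _ _) (Num.min 1 g) Lge rle m0 m1 eL => L m Lge rle m0 m1 eL.
have k0 : 0 < k%:R :> R by rewrite ltr0n (leq_trans _ k2).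
have rR : 0 < r%:R :> R by rewrite ltr0n.
(* Since ln (3 s) <= 3 s and L >= 1/2, the term 4 ln (3 s) is at most 24 s L. What remains is, after
   exponentiation, a polynomial inequality in E = exp L. *)
suff : conf_log k delta r <= 4 * ln (3 * s) + 6 * L.
  have : ln (3 * s) <= 3 * s by apply/ltW/ln_sublinear; lra.
  have := mulr_ge0 (ltac:(lra) : 0 <= s) (ltac:(lra) : 0 <= L - 2^-1); lra.
have -> : 4 * ln (3 * s) + 6 * L = ln ((3 * s) ^+ 4 * expR L ^+ 6).
  rewrite [in RHS]lnM ?posrE ?exprn_gt0 ?expR_gt0 //; last lra.
  rewrite lnXn; last lra.
  by rewrite (lnXn _ (expR_gt0 L)) expRK; ring.
rewrite /conf_log ler_ln ?posrE; last 2 first.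
- by rewrite divr_gt0 // ?mulr_gt0 // ?exprn_gt0 // pi_gt0.
- by rewrite mulr_gt0 ?exprn_gt0 ?expR_gt0 //; lra.
pose E := expR L; have E1 : 2 <= E.
  by rewrite /E eL ler_pdivlMr //; apply: le_trans kd; lra.
have LE : L <= E by apply: le_trans (expR_ge1Dx L); lra.
have kE : k%:R / delta = E * m by rewrite /E eL divfK // gt_eqF.
have r2 : r%:R ^+ 2 * m ^+ 4 <= 4 * s ^+ 4 * E ^+ 2.
  have -> : 4 * s ^+ 4 * E ^+ 2 = (2 * s ^+ 2 * E) ^+ 2 by ring.
  have -> : r%:R ^+ 2 * m ^+ 4 = (r%:R * m ^+ 2) ^+ 2 by ring.
  rewrite ler_pXn2r ?nnegrE ?mulr_ge0 ?sqr_ge0 //; try lra.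
  move: rle; rewrite mulrA ler_pdivlMr ?exprn_gt0 // => h; apply: le_trans h _.
  by rewrite mulrA; apply: ler_wpM2l => //; rewrite mulr_ge0 ?sqr_ge0.
have mE : 1 <= E * m by rewrite -kE; lra.
have p16 : pi ^+ 2 <= 16 :> R.
  rewrite (_ : 16 = 4 ^+ 2); last by rewrite -natrX.
  by rewrite ler_pXn2r ?nnegrE ?pi_ge0 //; have := @pihalf_lt2 R; lra.
have q0 : 0 < m^-1 by rewrite invr_gt0.
have qE : m^-1 <= E by rewrite -[_^-1]mul1r ler_pdivrMr.
move: (pi ^+ 2) (sqr_ge0 (@pi R)) p16 => p p0 p16.
have -> : p * k%:R * r%:R ^+ 2 / (2 * delta) = p / 2 * (k%:R / delta) * r%:R ^+ 2.
  by field; rewrite gt_eqF.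
rewrite kE -/E.
(* Powers of [m] are grouped so that r^2 m^4 <= 4 s^4 E^2 and m^-3 <= E^3 apply; pi^2 / 2 <= 8 stays
   below 81 / 4. *)
have -> : p / 2 * (E * m) * r%:R ^+ 2 = p / 2 * ((r%:R ^+ 2 * m ^+ 4) * (E * m^-1 ^+ 3)).
  by field; rewrite gt_eqF.
have -> : (3 * s) ^+ 4 * E ^+ 6 = 81 / 4 * ((4 * s ^+ 4 * E ^+ 2) * (E * E ^+ 3)) by field.
have E0 : 0 <= E by lra.
have s0 : 0 <= s by lra.
have m0' := ltW m0; have q0' := ltW q0.
apply: ler_pM; [by rewrite divr_ge0| |lra|].
  by rewrite !mulr_ge0 ?exprn_ge0.
apply: ler_pM => //; [by rewrite !mulr_ge0 ?exprn_ge0|by rewrite mulr_ge0 ?exprn_ge0|].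
by apply: ler_wpM2l => //; rewrite lerXn2r ?nnegrE.
Qed.
End elimination_round.

(** The constant depends on [B] and [m2bar] alone. The round is the ceiling of c L / min(1, g)^2,
    with [c] large enough for the radius to beat the gap and the pull count still linear in L. *)
Lemma elimination_round (R : realType) (B m2bar : R) : exists2 C : R, 0 <= C &
  forall (k : nat) (N delta g : R), (2 <= k)%N -> 8 <= N -> 0 < delta < 1 -> 0 < g ->
  exists r : nat, [/\ (0 < r)%N,
    4 * alpha B m2bar r (6 * delta / (pi ^+ 2 * k%:R * r%:R ^+ 2)) < g &
    (pull_count k N delta r)%:R <= C * ((g ^+ 2)^-1 + N) * log_term k delta g].
Proof.
pose A := 32 * B ^+ 2 * m2bar ^+ 2.
have A0 : 0 <= A by rewrite /A; have := mulr_ge0 (sqr_ge0 B) (sqr_ge0 m2bar); lra.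
(* The requirement A K < c is circular, as [K] comes from the bound on [conf_log] at a round of size
   governed by [c]. It is solvable because K = 24 s + 6 is linear in [s] while c = s^2 is
   quadratic. *)
pose s := 30 * A + 2; pose K := 24 * s + 6; pose c := s ^+ 2.
have s2 : 2 <= s by rewrite /s; lra.
have AKc : A * K < c by rewrite /K /c /s; nra.
have K0 : 0 <= K by rewrite /K; lra.
have c4 : 4 <= c by rewrite /c; nra.
(* In the bound on the pull count, 2 K + 4 covers N times the logarithms, one more unit covers the
   additive 1, and 4 c covers the term 2 r. *)
exists (2 * K + 5 + 4 * c); first by lra.
move=> k N delta g k2 N8 delta01 g0.
have Lge := log_term_ge k2 delta01 g0.
set L := log_term k delta g in Lge *.
set m := Num.min 1 g.
have m0 : 0 < m by rewrite lt_min g0 ltr01.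
have m1 : m <= 1 by rewrite ge_min lexx.
have mg : m <= g by rewrite ge_min lexx orbT.
have mV1 : 1 <= (m ^+ 2)^-1 by rewrite invr_ge1 ?unitfE ?gt_eqF ?exprn_gt0 // expr_le1 // ltW.
(* Truncating the gap at 1 costs only an additive 1, later absorbed by [N]. *)
have mVg : (m ^+ 2)^-1 <= 1 + (g ^+ 2)^-1.
  rewrite /m minEle; case: ifP => _; first by rewrite expr1n invr1 lerDl invr_ge0 sqr_ge0.
  by rewrite lerDr.
pose x := c * L / m ^+ 2.
have x1 : 1 <= x.
  have cL : 1 <= c * L by nra.
  by rewrite /x -[1]mulr1; apply: ler_pM.
exists (ceil_nat x); set r := ceil_nat x.
have xr : x <= r%:R by exact: ceil_nat_ge.
have r2x : r%:R <= 2 * x by have := @ceil_nat_le _ x ltac:(lra); rewrite -/r; lra.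
have rR : 0 < r%:R :> R by lra.
have r0 : (0 < r)%N by rewrite -(ltr0n R).
have LrK : conf_log k delta r <= K * L by exact: conf_log_le.
have Lr0 := conf_log_ge0 k2 delta01 r0.
split => //.
  have a0 := alpha_ge0 B m2bar r (6 * delta / (pi ^+ 2 * k%:R * r%:R ^+ 2)).
  rewrite -(@ltr_pXn2r _ 2) ?nnegrE ?(ltW g0) ?mulr_ge0 //.
  rewrite exprMn (alpha_conf_log B m2bar k2) //.
  have -> : 4 ^+ 2 * (2 * B ^+ 2 * m2bar ^+ 2 * conf_log k delta r / r%:R) =
      A * conf_log k delta r / r%:R by rewrite /A; ring.
  rewrite ltr_pdivrMr //.
  have h1 : A * conf_log k delta r <= A * K * L by rewrite -mulrA ler_wpM2l.
  have h2 : A * K * L < c * L by rewrite ltr_pM2r //; lra.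
  have h3 : c * L = m ^+ 2 * x by rewrite /x [RHS]mulrC divfK // gt_eqF // exprn_gt0.
  have h4 : m ^+ 2 * x <= g ^+ 2 * r%:R.
    apply: ler_pM => //; [exact: sqr_ge0|lra|].
    by rewrite lerXn2r ?nnegrE ?(ltW m0) ?(ltW g0).
  lra.
apply: le_trans (pull_count_le k2 N8 delta01 r) _.
set l := ln (_ / _).
have lr0 : 0 <= ln r%:R :> R by rewrite ln_ge0 // ler1n.
have Lr : conf_log k delta r = l + 2 * ln r%:R by exact: conf_logE.
have l0 : 0 <= l by rewrite ln_ge0 // conf_arg_ge1.
have lr1 : ln r.+1%:R <= 1 + ln r%:R :> R.
  apply: (@le_trans _ _ (ln (2 * r%:R))).
    rewrite ler_ln ?posrE ?mulr_gt0 ?ltr0n //.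
    by rewrite -natrM ler_nat mul2n -addnn -addn1 leq_add2l.
  by rewrite lnM ?posrE ?ltr0n // lerD2r ln2_le.
have h1 : l + 2 * ln r.+1%:R <= (2 * K + 4) * L by nra.
have h2 : 1 <= N * L by nra.
have h3 : 2 * r%:R <= 4 * c * (1 + (g ^+ 2)^-1) * L.
  apply: (@le_trans _ _ (4 * c * (m ^+ 2)^-1 * L)).
    by rewrite (_ : 4 * c * (m ^+ 2)^-1 * L = 2 * (2 * x)); [lra|rewrite /x; ring].
  by rewrite ler_wpM2r ?ler_wpM2l //; lra.
have gV0 : 0 <= (g ^+ 2)^-1 by rewrite invr_ge0 sqr_ge0.
move: ((g ^+ 2)^-1) gV0 h3 => G G0 h3.
have h4 : N * (l + 2 * ln r.+1%:R) <= N * ((2 * K + 4) * L) by rewrite ler_wpM2l //; lra.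
have GL : 0 <= G * L by rewrite mulr_ge0 //; lra.
have KGL : 0 <= K * (G * L) by rewrite mulr_ge0.
have cNL : 0 <= c * ((N - 1) * L) by rewrite !mulr_ge0 //; lra.
lra.
Qed.

(** * Successive elimination on a fixed sample table *)

Section algorithm.
Context {R : realType} (k : nat) (N B m2bar delta : R).

Definition conf_radius (r : nat) : R :=
  alpha B m2bar r (6 * delta / (pi ^+ 2 * k%:R * r%:R ^+ 2)).

Lemma survivesE (phat : 'I_k -> R) (S : {set 'I_k}) (i : 'I_k) (a : R) : 0 <= a ->
  (phat i >= \big[Num.max/phat i]_(j in S) phat j - 2 * a) =
  [forall j in S, phat j <= phat i + 2 * a].
Proof.
move=> a0; rewrite lerBlDr; apply/bigmax_leP/forall_inP => [[_ h]//|h].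
by split=> [|j jS]; [rewrite lerDl mulr_ge0|exact: h].
Qed.

Lemma pull_count0 : pull_count k N delta 0 = ceil_nat (N * ln (pi ^+ 2 * k%:R / (2 * delta))).
Proof. by rewrite /pull_count big_geq // addn0. Qed.

Lemma pull_countS r : pull_count k N delta r.+1 =
  (pull_count k N delta r + (1 + ceil_nat (2 * N * ln (r.+2%:R / r.+1%:R))))%N.
Proof. by rewrite /pull_count big_nat_recr //= addnA. Qed.

Lemma pull_count_homo : {homo pull_count k N delta : r s / (r <= s)%N}.
Proof.
move=> r s /subnK <-; elim: (s - r)%N => // n; rewrite addSn pull_countS.
by move/leq_trans; apply; exact: leq_addr.
Qed.

(** [lo i] and [hi i] stand for the limits m1 - U and m1 + U between which contamination can move
    the median of arm [i], and [rr i] for a round by which a suboptimal arm [i] must be gone. *)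
Variables (x : 'I_k -> nat -> R) (istar : 'I_k) (lo hi : 'I_k -> R) (rr : 'I_k -> nat).

Let phat i r := empirical_median (mkseq (x i) (pull_count k N delta r)).

(** State after [n] passes of the loop. The bounds on pulls also cover arms already eliminated, and
    [inv_progress] says that the loop has either ended or advanced one round per pass. *)
Record cbai_invariant (n : nat) (st : state k) : Prop := CbaiInvariant {
  inv_star : istar \in active st;
  inv_round : (0 < round st)%N;
  inv_pulls : forall i, i \in active st -> pulls st i = pull_count k N delta (round st).-1;
  inv_elim : forall i, i != istar -> i \in active st -> (round st <= rr i)%N;
  inv_other : forall i, i != istar -> (pulls st i <= pull_count k N delta (rr i))%N;
  inv_pulls_star : (pulls st istar <= \sum_(i | i != istar) pull_count k N delta (rr i))%N;
  inv_progress : (#|active st| <= 1)%N \/ round st = n.+1 }.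

Hypotheses (k2 : (2 <= k)%N) (rr0 : forall i, (0 < rr i)%N).
Hypothesis rr_sep : forall i, i != istar -> hi i + 4 * conf_radius (rr i) < lo istar.
Hypothesis good : forall i r, (0 < r <= \max_j rr j)%N ->
  lo i - conf_radius r <= phat i r <= hi i + conf_radius r.

Lemma card_gt1_other (S : {set 'I_k}) : (1 < #|S|)%N -> exists2 i, i \in S & i != istar.
Proof.
move=> S1; have [S0|[i /setD1P[iS Si]]] := set_0Vmem (S :\ istar); last by exists i.
by move: S1; rewrite (cardsD1 istar) S0 cards0 addn0; case: (_ \in _).
Qed.

Lemma pull_count_le_others i r : i != istar -> (r <= rr i)%N ->
  (pull_count k N delta r <= \sum_(j | j != istar) pull_count k N delta (rr j))%N.
Proof.
move=> ii ri; apply: leq_trans (pull_count_homo ri) _.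
by rewrite (bigD1 i) //= leq_addr.
Qed.

Lemma cbai_invariant_init : cbai_invariant 0 (cbai_init k N delta).
Proof.
have [i _ ii] : exists2 i, i \in [set: 'I_k]%SET & i != istar.
  by apply: card_gt1_other; rewrite cardsT card_ord.
split => //=; rewrite ?inE //.
- by move=> j _; rewrite pull_count0.
- by move=> j _; rewrite -pull_count0; exact: pull_count_homo.
- by rewrite -pull_count0; exact: pull_count_le_others ii _.
- by right.
Qed.

(** While some suboptimal arm is active, the round is at most its [rr], so all confidence intervals
    in use are valid. The optimal arm is then pulled exactly as often as that arm, which bounds its
    own pulls. *)
Lemma cbai_invariant_step n st : cbai_invariant n st ->
  cbai_invariant n.+1 (cbai_step N B m2bar delta x st).
Proof.
case: st => S r p [/= Ss r0 pS eS oS sS prog].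
rewrite /cbai_step /=; case: leqP => [S1|S1].
  by split => //=; left.
case: prog => [|rn]; first by rewrite leqNgt S1.
(* Before the pass the pulls are those of round [r - 1]; the medians are taken after the pulls of
   round [r]. *)
have pn i : i \in S ->
    (p i + (1 + ceil_nat (2 * N * ln (r.+1%:R / r%:R))))%N = pull_count k N delta r.
  by move=> iS; rewrite pS //; case: (r) r0 => // r' _; rewrite pull_countS.
have [i0 i0S i0s] := card_gt1_other S1.
have rmax i : i != istar -> i \in S -> (0 < r <= \max_j rr j)%N.
  by move=> ii iS; rewrite r0; apply: leq_trans (eS _ ii iS) _; exact: leq_bigmax.
have a0 q : 0 <= conf_radius q by exact: alpha_ge0.
rewrite -/(conf_radius r); set newS := finset _.
have newE i : (i \in newS) = (i \in S) && [forall j in S, phat j r <= phat i r + 2 * conf_radius r].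
  rewrite /newS inE; case: (boolP (i \in S)) => //= iS.
  pose q j := empirical_median (mkseq (x j)
    (if j \in S then (p j + (1 + ceil_nat (2 * N * ln (r.+1%:R / r%:R))))%N else p j)).
  have qE j : j \in S -> q j = phat j r by move=> jS; rewrite /q jS pn.
  have := survivesE q S i (a0 r); rewrite /q iS => ->.
  by apply: eq_forallb_in => j jS; rewrite -/(q j) qE // pn.
split => /=.
- rewrite newE Ss; apply/forall_inP => j jS.
  have [->|js] := eqVneq j istar; first by rewrite lerDl; exact: mulr_ge0 (ler0n R 2) (a0 r).
  have /andP[lo1 _] := good istar (rmax _ js jS).
  have /andP[_ hi1] := good j (rmax _ js jS).
  have := rr_sep js; have := a0 (rr j); lra.
- by [].
- by move=> i; rewrite newE => /andP[iS _]; rewrite iS pn.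
- move=> i ii; rewrite newE => /andP[iS /forall_inP/(_ _ Ss) h].
  (* In round [rr i] arm [i] cannot survive: two radii come from the two confidence intervals and
     two from the elimination threshold, hence the 4 in [rr_sep]. *)
  rewrite ltn_neqAle eS // andbT; apply: contraTneq h => rE.
  have /andP[lo1 _] := good istar (rmax _ ii iS).
  have /andP[_ hi1] := good i (rmax _ ii iS).
  have := rr_sep ii; rewrite -rE -ltNge; lra.
- move=> i ii; case: ifP => iS; last exact: oS.
  by rewrite pn //; apply: pull_count_homo; exact: eS.
- by rewrite Ss pn //; exact: pull_count_le_others i0s (eS _ i0s i0S).
- by right; rewrite rn.
Qed.

Lemma cbai_outputs : outputs_within N B m2bar delta x istar
  (2 * \sum_(i | i != istar) pull_count k N delta (rr i))%N%:R.
Proof.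
set st := fun n => iter n (cbai_step N B m2bar delta x) (cbai_init k N delta).
have inv n : cbai_invariant n (st n).
  elim: n => [|n IH]; first exact: cbai_invariant_init.
  by rewrite /st iterS; exact: cbai_invariant_step.
(* After that many passes an unfinished loop would be in a round beyond every [rr i], with no
   suboptimal arm left. *)
exists (\max_j rr j); rewrite -/(st _) /=.
have [Ss r0 pS eS oS sS prog] := inv (\max_j rr j).
split; last first.
  rewrite ler_nat (bigD1 istar) //= mul2n -addnn; apply: leq_add => //.
  by apply: leq_sum => i; exact: oS.
apply/eqP; rewrite finset.eqEsubset finset.sub1set Ss andbT; apply/fintype.subsetP => i iS.
rewrite inE; case: (eqVneq i istar) => // ii.
case: prog => [c1|rE].
  by move: c1; rewrite (cardsD1 istar) Ss (cardsD1 i) !inE ii iS.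
by have := eS _ ii iS; rewrite rE ltnNge leq_bigmax.
Qed.

End algorithm.

(** * Measurability of the outcome *)

Section measurability.
Context {R : realType} {d : measure_display} {T : measurableType d}.
Context (k : nat) (N B m2bar delta : R) (X : 'I_k -> nat -> T -> R).
Hypothesis mX : forall i s, measurable_fun setT (X i s).

Lemma measurable_const_prop (Q : Prop) : measurable [set _ : T | Q].
Proof.
have [q|nq] := pselect Q.
  by rewrite (_ : [set _ | Q] = setT) //; apply/seteqP; split.
by rewrite (_ : [set _ | Q] = set0) //; apply/seteqP; split.
Qed.

(** Pull counts are stored as a finite function so that codes form a countable type, and events can
    be split over all possible states by a countable union. *)
Definition decode_state (c : {set 'I_k} * nat * {ffun 'I_k -> nat}) : state k :=
  State c.1.1 c.1.2 c.2.

Definition encode_state (st : state k) : {set 'I_k} * nat * {ffun 'I_k -> nat} :=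
  (active st, round st, [ffun i => pulls st i]).

Lemma encode_stateK : cancel encode_state decode_state.
Proof.
by case=> S r p; rewrite /decode_state /=; congr State; apply/funext => i; rewrite ffunE.
Qed.

Let row (w : T) : 'I_k -> nat -> R := fun i s => X i s w.

Lemma measurable_survivors (S : {set 'I_k}) (n : 'I_k -> nat) (a : R) (A : {set 'I_k}) :
  0 <= a ->
  let phat w i := empirical_median (mkseq (row w i) (n i)) in
  measurable [set w | [set i in S | phat w i >=
      \big[Num.max/phat w i]_(j in S) phat w j - 2 * a]%SET = A].
Proof.
move=> a0 phat; pose b i w := [forall j in S, phat w j <= phat w i + 2 * a].
have mphat i : measurable_fun setT (phat^~ i) by exact: measurable_empirical_median.
rewrite (_ : [set w | _] = [set w | [set f : {ffun 'I_k -> bool} |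
    [set i in S | f i]%SET = A] [ffun i => b i w]]); last first.
  suff E w : [set i in S | phat w i >= \big[Num.max/phat w i]_(j in S) phat w j - 2 * a]%SET =
      [set i in S | [ffun i => b i w] i]%SET by apply/seteqP; split => w /=; rewrite E.
  by apply/setP => i; rewrite !inE ffunE (survivesE (phat w) S i a0).
apply: measurable_finite_info => i; rewrite /b.
rewrite (_ : [set w | _] = [set w | [set f : {ffun 'I_k -> bool} |
    [forall j in S, f j]] [ffun j => phat w j <= phat w i + 2 * a]]); last first.
  suff E w : [forall j in S, phat w j <= phat w i + 2 * a] =
      [forall j in S, [ffun j => phat w j <= phat w i + 2 * a] j].
    by apply/seteqP; split => w /=; rewrite E.
  by apply: eq_forallb_in => j _; rewrite ffunE.
apply: measurable_finite_info => j.
have mphat2 : measurable_fun setT (fun w => phat w i + 2 * a) by exact: measurable_funD.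
by have := measurable_fun_le measurableT (mphat j) mphat2; rewrite setTI.
Qed.

Lemma measurable_step c c' : measurable
  [set w | cbai_step N B m2bar delta (row w) (decode_state c) = decode_state c'].
Proof.
case: c c' => -[S r] p [[A r'] p']; rewrite /cbai_step /decode_state /=.
case: (#|S| <= 1)%N; first exact: measurable_const_prop.
set n := fun i => if i \in S then _ else _; set a := alpha _ _ _ _.
rewrite (_ : [set w | _] = [set w | [set i in S | empirical_median (mkseq (row w i) (n i)) >=
     \big[Num.max/empirical_median (mkseq (row w i) (n i))]_(j in S)
       empirical_median (mkseq (row w j) (n j)) - 2 * a]%SET = A] `&`
     [set _ | r.+1 = r' /\ n = p']); last first.
  by apply/seteqP; split => w /= [-> [-> ->]].
apply: measurableI; last exact: measurable_const_prop.
by apply: measurable_survivors; exact: alpha_ge0.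
Qed.

(** Needed to compare the success event with the good event by monotonicity of the measure. The law
    of the run is followed state by state, over countably many codes and passes. *)
Lemma measurable_outputs_within istar M :
  measurable [set w | outputs_within N B m2bar delta (row w) istar M].
Proof.
pose st n w := iter n (cbai_step N B m2bar delta (row w)) (cbai_init k N delta).
have mst n c : measurable [set w | st n w = decode_state c].
  elim: n c => [|n IH] c.
    exact: (measurable_const_prop (cbai_init k N delta = decode_state c)).
  rewrite (_ : [set w | _] = \bigcup_c' ([set w | st n w = decode_state c'] `&`
     [set w | cbai_step N B m2bar delta (row w) (decode_state c') = decode_state c])).
    apply: countable_bigcupT_measurable => [|c']; first exact: countableP.
    by apply: measurableI; [exact: IH|exact: measurable_step].
  apply/seteqP; split => w /=.
    by move=> h; exists (encode_state (st n w)) => //=; rewrite encode_stateK.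
  by move=> [c' _ [/= e <-]]; rewrite -e.
rewrite (_ : [set w | _] = \bigcup_n \bigcup_c ([set w | st n w = decode_state c] `&`
   [set _ | active (decode_state c) = [set istar]%SET /\
            (\sum_i pulls (decode_state c) i)%:R <= M])).
  apply: bigcupT_measurable => n.
  apply: countable_bigcupT_measurable => [|c]; first exact: countableP.
  by apply: measurableI; [exact: mst|exact: measurable_const_prop].
apply/seteqP; split => w.
  move=> [n h]; exists n => //; exists (encode_state (st n w)) => //.
  by split; rewrite /mkset encode_stateK.
by move=> [n _ [c _ [/= e h]]]; exists n; rewrite -/(st n w) e.
Qed.

End measurability.

(** * Confidence intervals *)

Section deviation.
Context {R : realType} {d : measure_display} {T : measurableType d}.
Context (P : probability T R) (adv : adversary) (k : nat) (eps tbar delta B m2bar : R).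
Context (F : 'I_k -> probability R R) (m1 m2 : 'I_k -> R).
Context (Y : 'I_k -> nat -> {RV P >-> R}) (D : 'I_k -> nat -> {RV P >-> bool}).
Context (Z : 'I_k -> nat -> {RV P >-> R}).
Hypotheses (k2 : (2 <= k)%N) (B0 : 0 < B) (eps12 : 0 < eps < 2^-1) (delta01 : 0 < delta < 1).
Hypothesis tb : eff_eps adv eps < tbar < 2^-1.
Hypothesis fam : forall i, in_family tbar B (F i) (m1 i) (m2 i).
Hypothesis m2m : forall i, m2 i <= m2bar.
Hypothesis cont : contaminated_by adv eps F Y D Z.

Let N := sample_factor adv eps tbar.
Let rad := conf_radius k B m2bar delta.
Let U i := uncertainty adv eps B (m2 i).

Lemma eff_eps_gt0 : 0 < eff_eps adv eps.
Proof.
have [e0 e2] := andP eps12.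
by case: (adv) => //=; rewrite divr_gt0 // mulr_gt0 //; lra.
Qed.

(** The margin tbar - eff_eps is positive and below 1/2. *)
Lemma sample_factor_ge8 : 8 <= N.
Proof.
have [et t2] := andP tb; have e0 := eff_eps_gt0.
have h0 : 0 < tbar - eff_eps adv eps by lra.
rewrite /N /sample_factor ler_pdivlMr ?exprn_gt0 //.
have -> : 2 = 8 * (2^-1) ^+ 2 :> R by field.
by rewrite ler_pM2l // lerXn2r ?nnegrE //; lra.
Qed.

Lemma measurable_observation i s :
  measurable_fun setT (fun w => observation Y D Z w i s).
Proof.
have mD : measurable_fun setT (fun w => (D i s w)%:R : R).
  apply: (@measurableT_comp _ _ _ _ _ _ (fun b : bool => b%:R : R)) => //.
apply: measurable_funD; apply: measurable_funM => //.
by apply: measurable_funB.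
Qed.

(* [true]: the median overshoots its confidence interval, [false]: it undershoots. *)
Definition deviation_side (i : 'I_k) (r : nat) (b : bool) : set R :=
  if b then `]m1 i + U i + rad r, +oo[%classic else `]-oo, m1 i - U i - rad r[%classic.

(** Phrased through the clean pairs and not through the median, so that its probability does not
    involve the contamination values. *)
Definition deviation_event (i : 'I_k) (r : nat) (b : bool) : set T :=
  let n := pull_count k N delta r in
  [set w | (n <= 2 * \sum_(t < n)
     (clean_pair Y D i t w \in spoiled (deviation_side i r b)))%N].

Lemma measurable_deviation_side i r b : measurable (deviation_side i r b).
Proof. by rewrite /deviation_side; case: b; exact: measurable_itv. Qed.

Lemma measurable_deviation_event i r b : measurable (deviation_event i r b).
Proof.
rewrite /deviation_event /=; set n := pull_count _ _ _ _; set C := deviation_side i r b.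
rewrite (_ : [set w | _] = [set w | [set f : {ffun 'I_n -> bool} |
   (n <= 2 * \sum_(t < n) f t)%N] [ffun t : 'I_n => clean_pair Y D i t w \in spoiled C]]); last first.
  suff E w : (\sum_(t < n) (clean_pair Y D i t w \in spoiled C) = \sum_(t < n)
     [ffun t : 'I_n => clean_pair Y D i t w \in spoiled C] t)%N.
    by apply/seteqP; split => w /=; rewrite E.
  by apply: eq_bigr => t _; rewrite ffunE.
apply: measurable_finite_info => t.
rewrite (_ : [set w | _] = clean_pair Y D i t @^-1` spoiled C); last first.
  by apply/seteqP; split => w /=; rewrite inE.
rewrite -[_ @^-1` _]setTI; apply: measurable_clean_pair => //.
by apply: measurable_spoiled; exact: measurable_deviation_side.
Qed.

Lemma deviation_event_prob i r b : (0 < r)%N ->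
  (P (deviation_event i r b) <= (2 * delta / (pi ^+ 2 * k%:R) * (r%:R ^+ 2)^-1)%:E)%E.
Proof.
move=> r0; have d0 : 0 < delta by case/andP: delta01.
have k0 : 0 < k%:R :> R by rewrite ltr0n (leq_trans _ k2).
have rR : 0 < r%:R :> R by rewrite ltr0n.
have [_ _ m20 _] := fam i.
have Bm0 : 0 < B * m2 i by rewrite mulr_gt0.
have [et t2] := andP tb; have e0 := eff_eps_gt0.
have tb12 : 0 < tbar < 2^-1 by apply/andP; split; lra.
have L0 := conf_log_ge0 k2 delta01 r0.
have rad0 : 0 <= rad r := alpha_ge0 _ _ _ _.
(* In units of B m2 the unavoidable uncertainty is exactly [eff_eps], the bias that spoiled samples
   can absorb. *)
have biasE : (U i + rad r) / (B * m2 i) = eff_eps adv eps + rad r / (B * m2 i).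
  by rewrite mulrDl /U /uncertainty [B * m2 i * _]mulrC mulfK // gt_eqF.
have U0 : 0 < U i by rewrite mulr_gt0.
apply: (@le_trans _ _ (expR (- conf_log k delta r))%:E).
  apply: (@spoiled_majority _ _ _ P adv k eps F Y D Z cont eps12 i _ _ tbar (rad r / (B * m2 i))) => //.
  - exact: measurable_deviation_side.
  - by rewrite divr_ge0 // ltW.
  - rewrite -biasE; case: b => /=.
      rewrite measure_itv_oinfty lee_fin.
      have := @family_cdfR_ge _ _ _ _ _ _ (fam i) tb12 (m1 i + U i + rad r) ltac:(lra).
      have -> : m1 i + U i + rad r - m1 i = U i + rad r by ring.
      lra.
    apply: le_trans (measure_itv_oo_le _ _) _; rewrite lee_fin.
    have := @family_cdfR_le _ _ _ _ _ _ (fam i) B0 tb12 (m1 i - U i - rad r) ltac:(lra).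
    have -> : m1 i - (m1 i - U i - rad r) = U i + rad r by ring.
    by [].
  - exact: (@pull_count_ge R k N delta k2 sample_factor_ge8 delta01 r r0).
  (* Here a^2 n = 2 [conf_log] (m2bar / m2)^2 (n / r), where m2 <= m2bar and n >= r, as every round
     adds at least one pull. *)
  - rewrite expr_div_n /rad /conf_radius (alpha_conf_log B m2bar k2 delta01 r0).
    have nr : r%:R <= (pull_count k N delta r)%:R :> R by rewrite ler_nat pull_count_ge_round.
    have mm : m2 i ^+ 2 <= m2bar ^+ 2.
      by rewrite lerXn2r ?nnegrE ?(ltW m20) // (le_trans (ltW m20)).
    have q1 : 1 <= m2bar ^+ 2 / m2 i ^+ 2 by rewrite ler_pdivlMr ?exprn_gt0 // mul1r.
    have q2 : 1 <= (pull_count k N delta r)%:R / r%:R :> R by rewrite ler_pdivlMr // mul1r.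
    have -> : 2 * B ^+ 2 * m2bar ^+ 2 * conf_log k delta r / r%:R / (B * m2 i) ^+ 2 *
        (pull_count k N delta r)%:R = 2 * conf_log k delta r *
        (m2bar ^+ 2 / m2 i ^+ 2 * ((pull_count k N delta r)%:R / r%:R)).
      by field; rewrite !gt_eqF.
    by apply: ler_peMr; [exact: mulr_ge0|exact: mulr_ege1].
rewrite lee_fin expRN /conf_log lnK; last first.
  by rewrite posrE !divr_gt0 ?mulr_gt0 ?exprn_gt0 ?pi_gt0.
by rewrite invf_div [(_ * r%:R ^+ 2)^-1]invfM mulrA.
Qed.

(** A median outside the interval puts at least half of the observations on one side, and an
    uncontaminated observation equals its clean value, so all of these are spoiled. *)
Lemma no_deviation_median i r w : (forall b, ~ deviation_event i r b w) ->
  (m1 i - U i) - rad r <=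
    empirical_median (mkseq (observation Y D Z w i) (pull_count k N delta r)) <=
  (m1 i + U i) + rad r.
Proof.
move=> nb; set n := pull_count _ _ _ _.
have key b (p : pred R) : (forall t, p (observation Y D Z w i t) ->
      deviation_side i r b (observation Y D Z w i t)) ->
    (n <= 2 * count p (mkseq (observation Y D Z w i) n))%N -> False.
  move=> pC h; apply: (nb b); rewrite /deviation_event /= -/n.
  apply: leq_trans h _; rewrite leq_mul2l /= count_mkseq; apply: leq_sum => t _.
  case: (boolP (p _)) => // /pC Ct; rewrite lt0b inE /spoiled /clean_pair /=.
  case Db : (D i t w); [by right|left].
  by move: Ct; rewrite /observation Db subr0 mul1r mul0r addr0.
apply/andP; split; rewrite leNgt; apply/negP.
  move/empirical_median_lt; rewrite size_mkseq; apply: (key false) => t /=.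
  by rewrite in_itv.
move/lt_empirical_median; rewrite size_mkseq; apply: (key true) => t /=.
by rewrite in_itv /= andbT.
Qed.

End deviation.

(** * Union bound over arms, rounds and sides, and conclusion *)

Lemma outputs_within_le (R : realType) (k : nat) (N B m2bar delta : R)
    (x : 'I_k -> nat -> R) (istar : 'I_k) (M M' : R) : M <= M' ->
  outputs_within N B m2bar delta x istar M -> outputs_within N B m2bar delta x istar M'.
Proof. by move=> MM' [n [h1 h2]]; exists n; split=> //; exact: le_trans h2 MM'. Qed.

Theorem theorem15 (R : realType) (B m2bar : R) (hB : 0 < B) :
  exists (C : R) (q : nat),
  forall (adv : adversary) (k : nat) (eps tbar delta : R)
    (d : measure_display) (T : measurableType d) (P : probability T R)
    (F : 'I_k -> probability R R) (m1 m2 : 'I_k -> R)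
    (Y : 'I_k -> nat -> {RV P >-> R})
    (D : 'I_k -> nat -> {RV P >-> bool})
    (Z : 'I_k -> nat -> {RV P >-> R})
    (istar : 'I_k),
  let N := sample_factor adv eps tbar in
  let gap := eff_gap adv eps B m1 m2 istar in
  (2 <= k)%N ->
  0 < eps < 2^-1 ->
  0 < delta < 1 ->
  eff_eps adv eps < tbar < 2^-1 ->
  (forall i, in_family tbar B (F i) (m1 i) (m2 i)) ->
  (forall i, m2 i <= m2bar) ->
  contaminated_by adv eps F Y D Z ->
  (forall i, m1 i <= m1 istar) ->
  (forall i, i != istar -> 0 < gap i) ->
  ((1 - delta)%:E <=
   P [set w | outputs_within N B m2bar delta (observation Y D Z w) istar
                (sample_bound C q N delta gap istar)])%E.
Proof.
have [C C0 HC] := elimination_round B m2bar.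
(* The factor 2 pays for the pulls of the optimal arm, which has no term of its own in the sum. *)
exists (2 * C), 0%N.
move=> adv k eps tbar delta d T P F m1 m2 Y D Z istar N gap k2 eps12 delta01 tb fam m2m cont _ gap0.
have N8 : 8 <= N := sample_factor_ge8 eps12 tb.
have d0 : 0 < delta by case/andP: delta01.
have k0 : 0 < k%:R :> R by rewrite ltr0n (leq_trans _ k2).
have /boolp.choice[rr rrP] (i : 'I_k) : exists r, (0 < r)%N /\ (i != istar ->
    4 * conf_radius k B m2bar delta r < gap i /\
    (pull_count k N delta r)%:R <= C * ((gap i ^+ 2)^-1 + N) * log_term k delta (gap i)).
  (* Nothing is asked of the round attached to the optimal arm beyond positivity. *)
  have [->|ii] := eqVneq i istar; first by exists 1%N.
  by have [r [r0 h1 h2]] := HC k N delta (gap i) k2 N8 delta01 (gap0 i ii); exists r.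
pose Rm := \max_j rr j.
pose bad (t : 'I_k * 'I_Rm * bool) :=
  deviation_event adv eps tbar delta B m2bar m1 m2 Y D t.1.1 t.1.2.+1 t.2.
have mbad t : measurable (bad t) by exact: measurable_deviation_event.
pose Bad := \bigcup_(t in [set: 'I_k * 'I_Rm * bool]) bad t.
have mBad : measurable Bad by apply: fin_bigcup_measurable => // t _; exact: mbad.
have PBad : (P Bad <= delta%:E)%E.
  apply: le_trans (measure_union_bound (D := xpredT) (F := bad) P mBad mbad _) _.
    by move=> w [t _ h]; exists t.
  (* Two sides, [k] arms and the sum of inverse squares give at most 2 k c 2 = 8 delta / pi^2 <=
     delta. *)
  pose c := 2 * delta / (pi ^+ 2 * k%:R).
  apply: (@le_trans _ _ (\sum_(t : 'I_k * 'I_Rm * bool) (c * (t.1.2.+1%:R ^+ 2)^-1)%:E)%E).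
    by apply: lee_sum => t _; exact: deviation_event_prob.
  rewrite sumEFin lee_fin.
  rewrite -(pair_bigA _ (fun (t : 'I_k * 'I_Rm) (b : bool) => c * (t.2.+1%:R ^+ 2)^-1)) /=.
  under eq_bigr do rewrite sumr_const card_bool.
  rewrite -(pair_bigA _ (fun (i : 'I_k) (r : 'I_Rm) => (c * (r.+1%:R ^+ 2)^-1) *+ 2)) /=.
  rewrite sumr_const card_ord sumrMnl -mulr_sumr -[_ *+ k]mulr_natr -[_ *+ 2]mulr_natr.
  have s2 := @sum_inv_sqr_le2 R Rm; have p8 := @pi_sqr_ge8 R.
  have s0 : 0 <= \sum_(r < Rm) (r.+1%:R ^+ 2)^-1 :> R.
    by apply: sumr_ge0 => r _; rewrite invr_ge0 sqr_ge0.
  have -> : c * (\sum_(r < Rm) (r.+1%:R ^+ 2)^-1) * 2 * k%:R =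
      4 * delta * (\sum_(r < Rm) (r.+1%:R ^+ 2)^-1) / pi ^+ 2.
    rewrite /c; move: (pi ^+ 2) p8 => p p8.
    by field; rewrite !gt_eqF //; lra.
  rewrite ler_pdivrMr; last lra.
  apply: (@le_trans _ _ (4 * delta * 2)).
    by apply: ler_wpM2l => //; lra.
  by rewrite -mulrA [4 * _]mulrC -mulrA ler_pM2l //; lra.
have mout : measurable [set w | outputs_within N B m2bar delta (observation Y D Z w) istar
    (sample_bound (2 * C) 0 N delta gap istar)].
  apply: (@measurable_outputs_within _ _ _ k N B m2bar delta
    (fun i s w => observation Y D Z w i s)) => i s.
  exact: measurable_observation.
apply: (@le_trans _ _ (P (~` Bad))).
  move: PBad; rewrite probability_setC // -(fineK (fin_num_measure P Bad mBad)) lee_fin => PBad.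
  by rewrite -[leRHS]/((1 - fine (P Bad))%:E) lee_fin lerD2l lerN2.
apply: le_measure; rewrite ?inE //; first exact: measurableC.
move=> w /= nB.
have ndev i r : (0 < r <= Rm)%N -> forall b,
    ~ deviation_event adv eps tbar delta B m2bar m1 m2 Y D i r b w.
  move=> /andP[]; case: r => // r _ rR b h; apply: nB.
  by exists (i, Ordinal rR, b).
have out := @cbai_outputs R k N B m2bar delta (observation Y D Z w) istar
  (fun i => m1 i - uncertainty adv eps B (m2 i)) (fun i => m1 i + uncertainty adv eps B (m2 i))
  rr k2 (fun i => (rrP i).1).
apply: outputs_within_le (out _ _).
- rewrite natrM natr_sum /sample_bound -mulrA; apply: ler_wpM2l => //.
  rewrite mulr_sumr; apply: ler_sum => i ii; rewrite expr0 mulr1 mulrA.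
  by have [] := (rrP i).2 ii.
- move=> i ii; have [h _] := (rrP i).2 ii.
  move: h; rewrite /gap /eff_gap; lra.
- by move=> i r rR; exact: no_deviation_median (ndev i r rR).
Qed.
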